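(* Let $x$ be an indeterminate. For each $k\ge1$ and $0\le r\le k$, as an identity of rational functions in $x$ over $\mathbb Q$, $$\det\big(\mathsf G_k^{(r)}\big)=\prod_{s=1}^{\lfloor (k-r)/2\rfloor}\left(\frac{u_{s+r}(x-1)}{u_{s-1}(x-1)}\right)^{\mathsf m_{k,r+2s}}.$$ In particular $\det\mathsf G_k^{(k)}=\det\mathsf G_k^{(k-1)}=1$, $\det\mathsf G_k^{(k-2)}=u_{k-1}(x-1)$ and $\det\mathsf G_k^{(k-3)}=u_{k-2}(x-1)^k$.
   Context: Motzkin algebra: a Motzkin $k$-diagram has top vertices $1..k$, bottom vertices $1'..k'$, edges each joining two distinct vertices, each vertex on at most one edge, edges planar. $\mathsf M_k(x)$: free module on such diagrams with product: stack $d_1$ above $d_2$, let $d_3$ join outer vertices connected by a path, $d_1d_2=x^\kappa d_3$, $\kappa$ the number of closed middle loops. Rank = number of vertical edges; $\mathsf J_{r-1}$ = span of diagrams of rank $\le r-1$. Motzkin paths: $p=(a_1,\dots,a_k)$, $a_i\in\{-1,0,1\}$, partial sums $\ge0$, rank $\sum a_i$; $\mathcal P_k^r$ those of rank $r$, $\mathsf m_{k,r}=|\mathcal P_k^r|$. Index $i$ with $a_i=1$ is paired with the smallest $j>i$ with $a_i+\dots+a_j=0$ if it exists. 1-factor of $p$: row $1..k$, paired indices joined by an edge, unpaired $a_i=1$ white, others black. For $p,q\in\mathcal P_k^r$, $d_p^q$ has bottom-row edges $i'$—$j'$ for edges $\{i,j\}$ of $p$, top-row edges $i$—$j$ for edges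 of $q$, and vertical edges joining the $s$-th white vertex of $q$ (top) to the $s$-th white vertex of $p$ (bottom); other vertices isolated. Bilinear form: $\langle p,q\rangle$ is defined by $d_p^pd_q^q\equiv\langle p,q\rangle d_q^p\pmod{\mathsf J_{r-1}}$ (so $\langle p,q\rangle=x^\kappa$ if the product has rank $r$, $\kappa$ the number of middle loops, and $0$ otherwise). $\mathsf G_k^{(r)}=(\langle p,q\rangle)_{p,q\in\mathcal P_k^r}$ (its determinant does not depend on the ordering of $\mathcal P_k^r$). Chebyshev: $u_0(y)=1$, $u_1(y)=y$, $u_m(y)=y\,u_{m-1}(y)-u_{m-2}(y)$. *)

(* Defs.v *)
From HB Require Import structures.
From mathcomp Require Import all_boot all_order all_algebra.
Set Implicit Arguments. Unset Strict Implicit. Unset Printing Implicit Defensive.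
Import Order.TTheory GRing.Theory Num.Theory.
Local Open Scope ring_scope.

Fixpoint cheb_aux (R : nzRingType) (y : R) (m : nat) : R * R :=
  match m with
  | 0%N => (1, y)
  | m'.+1 => let: (a, b) := cheb_aux y m' in (b, y * b - a)
  end.
Definition cheb (R : nzRingType) (y : R) (m : nat) : R := (cheb_aux y m).1.

(* A path of length k is a list of steps a_1..a_k in {-1,0,1} (0-indexed). *)
Fixpoint allseqs (n : nat) : seq (seq int) :=
  match n with
  | 0%N => [:: [::]]
  | n'.+1 => [seq a :: s | a <- [:: -1; 0; 1], s <- allseqs n']
  end.

Definition is_motzkin (s : seq int) : bool :=
  [forall i : 'I_(size s).+1, 0 <= \sum_(t < i) s`_t].

Definition path_rank (s : seq int) : int := \sum_(t < size s) s`_t.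

Definition motz (k r : nat) : seq (seq int) :=
  [seq s <- allseqs k | is_motzkin s && (path_rank s == r%:Z)].

Definition mkr (k r : nat) : nat := size (motz k r).

Definition psum (p : seq int) (i j : nat) : int := \sum_(i <= t < j.+1) p`_t.

Definition paired (p : seq int) (i j : nat) : bool :=
  [&& p`_i == 1, (i < j)%N, psum p i j == 0 &
      all (fun t => psum p i t != 0) (iota i (j - i))].

Definition white (k : nat) (p : seq int) (i : 'I_k) : bool :=
  (p`_i == 1) && ~~ [exists j : 'I_k, paired p i j].

Definition white_rank (k : nat) (p : seq int) (i : 'I_k) : nat :=
  #|[set t : 'I_k | white p t & (t < i)%N]|.

(* vertices: (true, i) = top vertex i, (false, i) = bottom vertex i' *)
Definition vtx (k : nat) := (bool * 'I_k)%type.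

(* d_p^q : bottom edges from p, top edges from q, vertical edges joining the
   s-th white vertex of q (top) to the s-th white vertex of p (bottom). *)
Definition dgm (k : nat) (p q : seq int) (v w : vtx k) : bool :=
  match v, w with
  | (false, i), (false, j) => paired p i j || paired p j i
  | (true, i), (true, j) => paired q i j || paired q j i
  | (true, i), (false, j) =>
      [&& white q i, white p j & white_rank q i == white_rank p j]
  | (false, j), (true, i) =>
      [&& white q i, white p j & white_rank q i == white_rank p j]
  end.

(* layers: 0 = top of d1, 1 = middle (bottom of d1 = top of d2), 2 = bottom of d2 *)
Definition svtx (k : nat) := ('I_3 * 'I_k)%type.

Definition stack_edge (k : nat) (d1 d2 : rel (vtx k)) (v w : svtx k) : bool :=
  ((v.1 <= 1)%N && (w.1 <= 1)%N && d1 (v.1 == 0 :> nat, v.2) (w.1 == 0 :> nat, w.2))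
  || ((1 <= v.1)%N && (1 <= w.1)%N && d2 (v.1 == 1 :> nat, v.2) (w.1 == 1 :> nat, w.2)).

Definition stackE (k : nat) (d1 d2 : rel (vtx k)) : rel (svtx k) :=
  fun v w => stack_edge d1 d2 v w || stack_edge d1 d2 w v.

(* rank of d1 d2 : number of vertical edges, i.e. top vertices of d1 joined by a
   path to a bottom vertex of d2 *)
Definition prod_rank (k : nat) (d1 d2 : rel (vtx k)) : nat :=
  #|[set i : 'I_k | [exists j : 'I_k,
       connect (stackE d1 d2) (ord0, i) (inord 2, j)]]|.

(* middle vertex on a closed loop: its whole component lies in the middle row and
   every vertex of it is on an edge of d1 and an edge of d2 *)
Definition on_loop (k : nat) (d1 d2 : rel (vtx k)) (v : svtx k) : bool :=
  [forall w, connect (stackE d1 d2) v w ==>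
     [&& w.1 == 1 :> nat, [exists u, d1 (false, w.2) u] & [exists u, d2 (true, w.2) u]]].

Definition nloops (k : nat) (d1 d2 : rel (vtx k)) : nat :=
  #|[set [set w | connect (stackE d1 d2) v w] | v in [set v | on_loop d1 d2 v]]|.

Definition Qx := {fraction {poly rat}}.
Definition xQ : Qx := FracField.tofrac ('X : {poly rat}).

Definition form (k r : nat) (p q : seq int) : Qx :=
  let d1 := @dgm k p p in let d2 := @dgm k q q in
  if prod_rank d1 d2 == r then xQ ^+ nloops d1 d2 else 0.

Definition Gram (k r : nat) : 'M[Qx]_(mkr k r) :=
  \matrix_(i, j) form k r (nth [::] (motz k r) i) (nth [::] (motz k r) j).

Definition uQ (m : nat) : Qx := cheb (xQ - 1) m.

(* Main.v *)
Require Import Defs.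
From HB Require Import structures.
From mathcomp Require Import all_boot all_order all_algebra.
From mathcomp Require Import perm ring zify.
Set Implicit Arguments. Unset Strict Implicit. Unset Printing Implicit Defensive.
Import Order.TTheory GRing.Theory Num.Theory.
Local Open Scope ring_scope.

(** At [x = M + 1] the form is an inner product of 0/1 vectors. Colour the [k]
    columns with [0, ..., M]; the vector of a path is the indicator of the
    colourings that are constant on its edges, take the value [0] on isolated
    vertices, and list [1, ..., r] on the white vertices. A closed loop of the
    glued diagram then contributes a factor [M + 1], an open component the
    factor 1 or 0, and the vector is computed by scanning the path with a stack
    of colours.

    Sorting the paths of length [k + 1] by their last step gives
    [det G_(k+1)^r = det G_k^(r-1) * det G_k^r * det G_k^(r+1) *
                     (u_(r+1) (M) / u_r (M)) ^ m_(k, r+1)].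
    Indeed, modulo the vectors of paths ending in [1] or [0], a path ending in
    [-1] may be replaced by one whose stack is a Jones-Wenzl vector, that is a
    vector killed by contraction of any two neighbouring slots. Pairing two
    paths defines a planar tensor in their stacks, so a Jones-Wenzl vector is
    orthogonal to every shorter stack and sees only the identity diagram on
    stacks of equal length; its norm is the ratio of Chebyshev polynomials.
    The resulting identity of polynomials in [x] holds at infinitely many
    integers. *)

(** * Sums over words *)

(** The Chebyshev argument is [x - 1] because flat steps split off the colour 0: a Jones-Wenzl
    vector must be killed by dots as well as by caps, hence vanishes on words containing 0, and a
    loop of nonzero colours counts [M = x - 1]. No general Jones-Wenzl projector is built. The
    labels of the white vertices are distinct and nonzero, so the indicator of the label word is
    already a Jones-Wenzl vector. A down step puts one more colour on top, and a correction is
    needed only when this colour repeats the label below it. Its coefficients come from the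
    continued fraction M - 1/(M - ...), which is u_(r+1)/u_r at M. Planarity replaces topology. That
    the strands of a product of full rank keep their order follows from a count of colourings: the
    count is nonzero, while the planar pairing of the label word with any other word is 0. The
    elimination divides by Chebyshev values and uses up one colour per label, so it is carried out
    at large integers [M], where these values are positive. *)

Section WordSums.
Variables (R : comNzRingType) (C : finType).
Implicit Types (f g : seq C -> R) (s t : seq C).

Fixpoint sumw (n : nat) f : R :=
  if n is n'.+1 then \sum_(x : C) sumw n' (fun s => f (x :: s)) else f [::].

Lemma sumwS n f : sumw n.+1 f = \sum_x sumw n (fun s => f (x :: s)).
Proof. by []. Qed.

Lemma eq_sumw n f g : (forall s, size s = n -> f s = g s) -> sumw n f = sumw n g.
Proof.
elim: n f g => [|n IH] f g fg /=; first exact: fg.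
by apply: eq_bigr => x _; apply: IH => s sn; apply: fg; rewrite /= sn.
Qed.

Lemma sumw0 n : sumw n (fun=> 0) = 0.
Proof. by elim: n => //= n IH; rewrite big1. Qed.

Lemma sumw_eq0 n f : (forall s, size s = n -> f s = 0) -> sumw n f = 0.
Proof. by move=> f0; rewrite -(sumw0 n); apply: eq_sumw. Qed.

Lemma sumwD n f g : sumw n (fun s => f s + g s) = sumw n f + sumw n g.
Proof.
elim: n f g => //= n IH f g; rewrite -big_split; apply: eq_bigr => x _; exact: IH.
Qed.

Lemma sumwZ n a f : sumw n (fun s => a * f s) = a * sumw n f.
Proof.
elim: n f => //= n IH f; rewrite mulr_sumr; apply: eq_bigr => x _; exact: IH.
Qed.

Lemma sumwZr n a f : sumw n (fun s => f s * a) = sumw n f * a.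
Proof. by rewrite mulrC -sumwZ; apply: eq_sumw => s _; rewrite mulrC. Qed.

Lemma sumwN n f : sumw n (fun s => - f s) = - sumw n f.
Proof. by rewrite -mulN1r -sumwZ; apply: eq_sumw => s _; rewrite mulN1r. Qed.

Lemma sumwB n f g : sumw n (fun s => f s - g s) = sumw n f - sumw n g.
Proof. by rewrite sumwD sumwN. Qed.

Lemma sumw_sum (I : finType) (P : pred I) n (F : I -> seq C -> R) :
  sumw n (fun s => \sum_(i | P i) F i s) = \sum_(i | P i) sumw n (F i).
Proof.
elim: n F => //= n IH F; rewrite exchange_big; apply: eq_bigr => x _; exact: IH.
Qed.

Lemma exchange_sumw m n (F : seq C -> seq C -> R) :
  sumw m (fun s => sumw n (F s)) = sumw n (fun t => sumw m (F^~ t)).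
Proof.
elim: m F => //= m IH F; rewrite sumw_sum; apply: eq_bigr => x _; exact: IH.
Qed.

Lemma sumw_cat m n f :
  sumw (m + n) f = sumw m (fun s => sumw n (fun t => f (s ++ t))).
Proof. by elim: m f => //= m IH f; apply: eq_bigr => x _; rewrite IH. Qed.

Lemma sumw_delta n s0 f : size s0 = n ->
  sumw n (fun s => (s == s0)%:R * f s) = f s0.
Proof.
elim: n s0 f => [|n IH] [|x s0] f //= sn; first by rewrite mul1r.
case: sn => sn.
rewrite (bigD1 x) //= [X in _ + X]big1 => [|z /negPf zx]; last first.
  by apply: sumw_eq0 => s _; rewrite eqseq_cons zx mul0r.
rewrite addr0 -(IH s0 (fun s => f (x :: s))) //.
by apply: eq_sumw => s _; rewrite eqseq_cons eqxx.
Qed.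

Lemma sum_delta (x0 : C) (f : C -> R) : \sum_x (x == x0)%:R * f x = f x0.
Proof.
rewrite (bigD1 x0) //= eqxx mul1r big1 ?addr0 // => x /negPf ->.
by rewrite mul0r.
Qed.

End WordSums.
Arguments sumw : simpl never.

Ltac lsize :=
  repeat match goal with H : @eq nat _ _ |- _ => revert H end;
  rewrite ?size_cat ?size_rcons /= ?size_cat ?size_rcons; lia.

Lemma split_at (T : Type) (z : seq T) i : (i <= size z)%N -> exists z1 z2, z = z1 ++
  z2 /\ size z1 = i.
Proof.
move=> h; exists (take i z), (drop i z); rewrite cat_take_drop; split => //.
by rewrite size_take_min; lia.
Qed.

Lemma take_drop_splice (T : Type) i (a b x : seq T) : size a = i ->
  take i (a ++ b) ++ x ++ drop i (a ++ b) = a ++ x ++ b.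
Proof. by move=> <-; rewrite take_size_cat // drop_size_cat. Qed.

(** * Planar tensors *)

Section Planar.
Variables (R : comNzRingType) (M : nat).
Notation C := 'I_M.+1.
Implicit Types (F G H : seq C -> R) (s t z : seq C).

(** Tensors of non-crossing partial matchings of [n] slots on a line, up to a scalar; an unmatched
    slot must carry the colour 0. [PlanarNil] holds the scalar, as [G [::]] is arbitrary. Each
    factorisation is demanded only on words of the right length, so no functional extensionality is
    involved. *)
Inductive planar : nat -> (seq C -> R) -> Prop :=
| PlanarNil G : planar 0 G
| PlanarCup n i F G : planar n F -> (i <= n)%N ->
    (forall z1 z2 x y, size z1 = i -> size (z1 ++ z2) = n ->
       G (z1 ++ x :: y :: z2) = (x == y)%:R * F (z1 ++ z2)) -> planar n.+2 G
| PlanarDot n i F G : planar n F -> (i <= n)%N ->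
    (forall z1 z2 x, size z1 = i -> size (z1 ++ z2) = n ->
       G (z1 ++ x :: z2) = (x == ord0)%:R * F (z1 ++ z2)) -> planar n.+1 G.

(** Scalars sink to the [PlanarNil] leaf. This absorbs the factor of a closed loop in
    [planar_cap]. *)
Lemma planar_scale n a F G : planar n F ->
  (forall z, size z = n -> G z = a * F z) -> planar n G.
Proof.
move=> pF; elim: pF G => {n F} [F|n i F F' pF IH le_in HF'|n i F F' pF IH le_in HF'] G HG.
- exact: PlanarNil.
- apply: (@PlanarCup n i (fun z => a * F z)); [exact: IH | by [] |].
  move=> z1 z2 x y h1 h2; rewrite HG ?HF' //; first by rewrite mulrCA.
  by move: h2; rewrite !size_cat /= => <-; lia.
- apply: (@PlanarDot n i (fun z => a * F z)); [exact: IH | by [] |].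
  move=> z1 z2 x h1 h2; rewrite HG ?HF' //; first by rewrite mulrCA.
  by move: h2; rewrite !size_cat /= => <-; lia.
Qed.

Lemma planar_ext n F G : planar n F ->
  (forall z, size z = n -> G z = F z) -> planar n G.
Proof. by move=> pF FG; apply: (planar_scale (a := 1) pF) => z /FG ->; rewrite mul1r. Qed.




(** Setting slot [i] to 0 removes a dot sitting there, or turns the other leg of a cup ending there
    into a dot. A cup or dot elsewhere is put back after the induction, at a shifted position. *)
Lemma planar_cap0 N n i F H : planar N F -> N = n.+1 -> (i <= n)%N ->
  (forall z1 z2, size z1 = i -> size (z1 ++ z2) = n ->
     H (z1 ++ z2) = F (z1 ++ ord0 :: z2)) -> planar n H.
Proof.
move=> pF; elim: pF n i H => {N F} [F //|N j F G pF IH jN HG|N j F G pF IH jN HG] n i H.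
- case=> <- {n} iN HH.
  have splice n' i' : n'.+1 = N -> (i' <= n')%N ->
      planar n' (fun z => F (take i' z ++ [:: ord0] ++ drop i' z)).
    by move=> Nn in'; apply: IH (esym Nn) in' _ => z1 z2 h1 h2; rewrite take_drop_splice.
  case: (ltngtP i j) => ij.
  + case: N pF IH jN HG iN HH splice => [|N] pF IH jN HG iN HH splice; first lia.
    apply: (@PlanarCup N j.-1 _ _ (splice N i _ _)) => //; try lia.
    move=> z1 z2 x y h1 h2; have [|a [b [ez sa]]] := @split_at _ z1 i; first lia.
    subst z1; rewrite -!catA take_drop_splice // HH //; last lsize.
    rewrite -!cat_cons catA HG -?catA //; lsize.
  + case: (ltngtP i j.+1) => ij1; first lia; last first.
      apply: (@PlanarDot N j F) => // z1 z2 x h1 h2.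
      rewrite -cat_rcons HH; [|lsize..].
      by rewrite cat_rcons HG.
    case: N pF IH jN HG iN HH splice => [|N] pF IH jN HG iN HH splice; first lia.
    apply: (@PlanarCup N j _ _ (splice N i.-2 _ _)) => //; try lia.
    move=> z1 z2 x y h1 h2; have [|a [b [ez sa]]] := @split_at _ z2 (i - j.+2); first lsize.
    subst z2.
    rewrite (catA z1) take_drop_splice; last lsize.
    have -> : z1 ++ x :: y :: a ++ b = (z1 ++ x :: y :: a) ++ b by rewrite -catA.
    rewrite HH; [|lsize..].
    by rewrite -catA /= HG -?catA //; lsize.
  + apply: (@PlanarDot N j F) => // z1 z2 x h1 h2.
    rewrite HH ?HG //; [|lsize..].
    by rewrite eq_sym.
- case=> <- {n} iN HH.
  have splice n' i' : n'.+1 = N -> (i' <= n')%N ->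
      planar n' (fun z => F (take i' z ++ [:: ord0] ++ drop i' z)).
    by move=> Nn in'; apply: IH (esym Nn) in' _ => z1 z2 h1 h2; rewrite take_drop_splice.
  case: (ltngtP i j) => ij.
  + case: N pF IH jN HG iN HH splice => [|N] pF IH jN HG iN HH splice; first lia.
    apply: (@PlanarDot N j.-1 _ _ (splice N i _ _)) => //; try lia.
    move=> z1 z2 x h1 h2; have [|a [b [ez sa]]] := @split_at _ z1 i; first lia.
    subst z1; rewrite -!catA take_drop_splice // HH //; last lsize.
    rewrite -!cat_cons catA HG -?catA //; lsize.
  + case: N pF IH jN HG iN HH splice => [|N] pF IH jN HG iN HH splice; first lia.
    apply: (@PlanarDot N j _ _ (splice N i.-1 _ _)) => //; try lia.
    move=> z1 z2 x h1 h2; have [|a [b [ez sa]]] := @split_at _ z2 (i - j.+1); first lsize.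
    subst z2.
    rewrite (catA z1) take_drop_splice; last lsize.
    have -> : z1 ++ x :: a ++ b = (z1 ++ x :: a) ++ b by rewrite -catA.
    rewrite HH; [|lsize..].
    by rewrite -catA /= HG -?catA //; lsize.
  + apply: (planar_ext pF) => z sz.
    have [|a [b [ez sa]]] := @split_at _ z i; first lia.
    subst z.
    by rewrite HH ?HG ?eqxx ?mul1r //; lsize.
Qed.

(** A contraction meeting a cup in both legs closes a loop, with factor [#|C|]; meeting it in one
    leg, it straightens a zigzag; meeting a dot, it forces the neighbouring slot to 0, which is
    [planar_cap0]. In the remaining positions the two commute. *)
Lemma planar_cap N n i F H : planar N F -> N = n.+2 -> (i <= n)%N ->
  (forall z1 z2, size z1 = i -> size (z1 ++ z2) = n ->
     H (z1 ++ z2) = \sum_x F (z1 ++ x :: x :: z2)) -> planar n H.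
Proof.
move=> pF; elim: pF n i H => {N F} [F //|N j F G pF IH jN HG|N j F G pF IH jN HG] n i H.
- case=> <- {n} iN HH.
  have splice n' i' : n'.+2 = N -> (i' <= n')%N ->
      planar n' (fun z => \sum_x F (take i' z ++ [:: x; x] ++ drop i' z)).
    move=> Nn in'; apply: IH (esym Nn) in' _ => z1 z2 h1 h2.
    by apply: eq_bigr => x _; rewrite take_drop_splice.
  case: (ltngtP i j) => ij.
  + case: (ltngtP i.+1 j) => ij1; last first.
    * apply: (planar_ext pF) => z sz.
      have [|a [[|y b] [ez sa]]] := @split_at _ z i; first lia.
        by move: (congr1 size ez); lsize.
      subst z.
      rewrite HH; [|lsize..].
      under eq_bigr => x _.
        rewrite -cat_rcons HG; [|lsize..].
        rewrite cat_rcons; over.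
      exact: sum_delta.
    * lia.
    case: N pF IH jN HG iN HH splice => [|[|N]] pF IH jN HG iN HH splice; try lia.
    apply: (@PlanarCup N j.-2 _ _ (splice N i _ _)) => //; try lia.
    move=> z1 z2 x y h1 h2; have [|a [b [ez sa]]] := @split_at _ z1 i; first lia.
    subst z1; rewrite -!catA HH //; last lsize.
    rewrite mulr_sumr; apply: eq_bigr => u _; rewrite take_drop_splice //.
    have -> : a ++ [:: u, u & b ++ [:: x, y & z2]] = (a ++ [:: u, u & b]) ++ [:: x, y & z2].
      by rewrite -catA.
    by rewrite HG -?catA //; lsize.
  + case: (ltngtP i j.+1) => ij1; first lia; last first.
      apply: (planar_ext pF) => z sz.
      have [|a [b [ez sa]]] := @split_at _ z i; first lia.
    subst z.
      case/lastP: a sz sa => [|a y] sz sa; first by move: sa => /=; lia.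
      rewrite HH; [|lsize..].
      under eq_bigr => x _.
        rewrite cat_rcons HG; [|lsize..].
        rewrite eq_sym; over.
      by rewrite sum_delta cat_rcons.
    case: N pF IH jN HG iN HH splice => [|[|N]] pF IH jN HG iN HH splice; try lia.
    apply: (@PlanarCup N j _ _ (splice N i.-2 _ _)) => //; try lia.
    move=> z1 z2 x y h1 h2; have [|a [b [ez sa]]] := @split_at _ z2 (i - j.+2); first lsize.
    subst z2.
    have -> : z1 ++ x :: y :: a ++ b = (z1 ++ x :: y :: a) ++ b by rewrite -catA.
    rewrite HH; [|lsize..].
    rewrite mulr_sumr; apply: eq_bigr => u _.
    rewrite (catA z1) take_drop_splice; last lsize.
    by rewrite -catA /= HG -?catA //; lsize.
  + apply: (planar_scale (a := #|C|%:R) pF) => z sz.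
    have [|a [b [ez sa]]] := @split_at _ z i; first lia.
    subst z.
    rewrite HH; [|lsize..].
    rewrite mulr_natl -sumr_const; apply: eq_bigr => x _.
    by rewrite HG ?eqxx ?mul1r //; lsize.
- case=> Nn iN HH; subst N.
  case: (ltngtP j i) => ij.
  + case: n iN pF IH jN HG HH => [|n] iN pF IH jN HG HH; first lia.
    have pF' : planar n (fun z => \sum_x F (take i.-1 z ++ [:: x; x] ++ drop i.-1 z)).
      apply: (IH n i.-1) => //; first lia.
      by move=> z1 z2 h1 h2; apply: eq_bigr => x _; rewrite take_drop_splice.
    apply: (@PlanarDot n j _ _ pF') => [|z1 z2 x h1 h2]; first lia.
    have [|a [b [ez sa]]] := @split_at _ z2 (i - j.+1); first lsize.
    subst z2.
    have -> : z1 ++ x :: a ++ b = (z1 ++ x :: a) ++ b by rewrite -catA.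
    rewrite HH; [|lsize..].
    rewrite mulr_sumr; apply: eq_bigr => u _.
    rewrite (catA z1) take_drop_splice; last lsize.
    by rewrite -catA /= HG -?catA //; lsize.
  + case: (ltngtP j i.+1) => ij1; first lia.
      case: n iN pF IH jN HG HH => [|n] iN pF IH jN HG HH; first lia.
      have pF' : planar n (fun z => \sum_x F (take i z ++ [:: x; x] ++ drop i z)).
        apply: (IH n i) => //; first lia.
        by move=> z1 z2 h1 h2; apply: eq_bigr => x _; rewrite take_drop_splice.
      apply: (@PlanarDot n j.-2 _ _ pF') => [|z1 z2 x h1 h2]; first lia.
      have [|a [b [ez sa]]] := @split_at _ z1 i; first lia.
      subst z1; rewrite -!catA HH //; last lsize.
      rewrite mulr_sumr; apply: eq_bigr => u _; rewrite take_drop_splice //.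
      have -> : a ++ [:: u, u & b ++ (x :: z2)] = (a ++ [:: u, u & b]) ++ (x :: z2).
      by rewrite -catA.
    by rewrite HG -?catA //; lsize.
    apply: (@planar_cap0 _ n i F H pF) => // z1 z2 h1 h2; rewrite HH //.
    under eq_bigr => x _.
      rewrite -cat_rcons HG; [|lsize..].
      rewrite cat_rcons; over.
    exact: sum_delta.
  + apply: (@planar_cap0 _ n i F H pF) => // z1 z2 h1 h2; rewrite HH //.
    under eq_bigr => x _ do (rewrite HG; [|lsize..]).
    exact: sum_delta.
Qed.
End Planar.

(** * Jones-Wenzl vectors *)

Section JonesWenzl.
Variables (R : comNzRingType) (M : nat).
Notation C := 'I_M.+1.
Implicit Types (F G Z T : seq C -> R) (s t z : seq C).

(** The usual Jones-Wenzl condition together with vanishing on words that contain 0: Motzkin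
    diagrams have isolated vertices besides edges, and both must be killed. *)
Definition jw n Z :=
  (forall s1 s2, (size (s1 ++ s2)).+2 = n -> \sum_x Z (s1 ++ x :: x :: s2) = 0)
  /\ (forall s1 s2, (size (s1 ++ s2)).+1 = n -> Z (s1 ++ ord0 :: s2) = 0).

Lemma jw_cons n Z x : jw n.+1 Z -> jw n (fun s => Z (x :: s)).
Proof.
by case=> Z1 Z2; split=> s1 s2 h; [apply: (Z1 (x :: s1)) | apply: (Z2 (x :: s1))];
  rewrite /= h.
Qed.

Lemma sumw_split1 a b (f : seq C -> R) :
  sumw (a + b.+1) f = sumw a (fun s1 => \sum_x sumw b (fun s2 => f (s1 ++ x :: s2))).
Proof. by rewrite sumw_cat. Qed.

Lemma sumw_split2 a b (f : seq C -> R) : sumw (a + b.+2) f =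
  sumw a (fun s1 => \sum_x \sum_y sumw b (fun s2 => f (s1 ++ x :: y :: s2))).
Proof. by rewrite sumw_cat. Qed.

(** In [catrev s t] the stacks meet top to top. A cup inside [s] is killed by [Z]; a cup inside [t]
    contracts [T] and leaves a second stack that is strictly shorter; a cup joining the two tops
    slices [Z] and [T] at a common head. Only the fully nested matching of [s] with [t] survives,
    and [beta] is its scalar. *)
Lemma planar_jw N F : planar N F -> exists beta, forall n m Z T,
  (n + m = N)%N -> (m <= n)%N -> jw n Z ->
  sumw n (fun s => sumw m (fun t => Z s * T t * F (catrev s t))) =
  if m == n then beta * sumw n (fun s => Z s * T s) else 0.
Proof.
elim=> {N F} [F|N i F G pF [beta IH] iN HG|N i F G pF [beta IH] iN HG].
- exists (F [::]) => n m Z T nm _ _; have [-> ->] : n = 0%N /\ m = 0%N by lia.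
  by rewrite /= mulrC.
(* The scalar is chosen before [n]. When [m = n], the cup joins the two tops exactly for [n = i.+1],
   that is [2 (i + 1) = N + 2]; in any other position it lies inside one stack and the pairing is
   0. *)
- exists (if (i.+1).*2 == N.+2 then beta else 0) => n m Z T nm mn jwZ.
  case: (ltngtP i.+1 n) => hin.
  + have -> : sumw n (fun s => sumw m (fun t => Z s * T t * G (catrev s t))) = 0.
      rewrite exchange_sumw; apply: sumw_eq0 => t st.
      have -> : n = ((n - i.+2) + i.+2)%N by lia.
      rewrite sumw_split2; apply: sumw_eq0 => s1 h1.
      transitivity (sumw i (fun s2 => T t * F (rev s2 ++ catrev s1 t)
                                      * (\sum_x Z (s1 ++ x :: x :: s2)))).
        under eq_bigr => x _ do rewrite -sumw_sum.
        rewrite -sumw_sum; apply: eq_sumw => s2 h2.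
        rewrite mulr_sumr; apply: eq_bigr => x _.
        transitivity (\sum_y (y == x)%:R * (Z (s1 ++ x :: y :: s2) * T t * F (rev s2 ++
          catrev s1 t))).
          apply: eq_bigr => y _.
          have -> : catrev (s1 ++ x :: y :: s2) t = rev s2 ++ y :: x :: catrev s1 t.
            by rewrite !catrevE rev_cat !rev_cons -catA !cat_rcons.
          rewrite HG ?size_rev // ?size_cat; first by ring.
          by rewrite catrevE !size_cat !size_rev h1 h2 st; lia.
        by rewrite sum_delta; ring.
      apply: sumw_eq0 => s2 h2; case: jwZ => Z1 _.
      by rewrite Z1 ?mulr0 // size_cat h1 h2; lia.
    by case: (m =P n) => // mn'; case: eqP => [h|_]; [exfalso; lia | rewrite mul0r].
  + have [j [b [ij bm]]] : exists j b, i = (n + j)%N /\ m = (j + b.+2)%N.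
      by exists (i - n)%N, (m - (i - n).+2)%N; lia.
    pose T' t := \sum_x T (take j t ++ x :: x :: drop j t).
    have := IH n (j + b)%N Z T'; rewrite (_ : (_ == n) = false); last by apply/eqP; lia.
    move=> hIH.
    have -> : (if m == n then (if (i.+1).*2 == N.+2 then beta else 0) *
                 sumw n (fun s => Z s * T s) else 0) = 0.
      by case: (m =P n) => // mn'; case: eqP => [h|_]; [exfalso; lia | rewrite mul0r].
    rewrite -hIH //; try lia.
    apply: eq_sumw => s sn; rewrite bm sumw_split2 sumw_cat; apply: eq_sumw => t1 h1.
    under eq_bigr => x _ do rewrite -sumw_sum.
    rewrite -sumw_sum; apply: eq_sumw => t2 h2.
    rewrite /T' take_size_cat // drop_size_cat // mulr_sumr mulr_suml.
    apply: eq_bigr => x _.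
    transitivity (\sum_y (y == x)%:R * (Z s * T (t1 ++ x :: y :: t2) *
      F (catrev s (t1 ++ t2)))).
      apply: eq_bigr => y _.
      rewrite !catrevE catA HG ?size_cat ?size_rev ?sn ?h1 ?h2 // -?catA; last lia.
      by rewrite eq_sym; ring.
    by rewrite sum_delta.
  + case: n m nm mn hin jwZ => [|n] [|m] nm mn hin jwZ; try lia.
    rewrite eqSS.
    transitivity (\sum_x if m == n then beta * sumw n (fun s => Z (x :: s) *
      T (x :: s)) else 0).
      apply: eq_bigr => x _.
      have := IH n m (fun s => Z (x :: s)) (fun s => T (x :: s)) => <-; try lia;
        last exact: jw_cons.
      change (sumw n (fun s => \sum_y sumw m (fun t =>
         Z (x :: s) * T (y :: t) * G (catrev (x :: s) (y :: t)))) = 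
         sumw n (fun s => sumw m (fun t => Z (x :: s) * T (x :: t) * F (catrev s t)))).
      rewrite sumw_sum.
      transitivity (\sum_y (y == x)%:R * (sumw n (fun s => sumw m (fun t =>
             Z (x :: s) * T (y :: t) * F (catrev s t))))).
        apply: eq_bigr => y _; rewrite -sumwZ; apply: eq_sumw => s sn.
        rewrite -sumwZ; apply: eq_sumw => t tm.
        rewrite /= !catrevE HG ?size_cat ?size_rev ?sn ?tm //; try lia.
        by rewrite eq_sym; ring.
      by rewrite sum_delta.
    case: (m =P n) => mn'; last by rewrite big1.
    rewrite mulr_sumr; case: eqP => [//|h]; exfalso; lia.
(* The nested matching has no dot: a dot on the first stack meets [Z], and a dot on the second makes
   that stack strictly shorter than the first. *)
- exists 0 => n m Z T nm mn jwZ; rewrite mul0r if_same.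
  case: (leqP n i) => hin.
  + have [j [b [ij bm]]] : exists j b, i = (n + j)%N /\ m = (j + b.+1)%N.
      by exists (i - n)%N, (m - (i - n).+1)%N; lia.
    pose T' t := T (take j t ++ ord0 :: drop j t).
    have := IH n (j + b)%N Z T'; rewrite (_ : (_ == n) = false); last by apply/eqP; lia.
    move=> <- //; try lia.
    apply: eq_sumw => s sn; rewrite bm sumw_split1 sumw_cat; apply: eq_sumw => t1 h1.
    rewrite -sumw_sum; apply: eq_sumw => t2 h2.
    rewrite /T' take_size_cat // drop_size_cat //.
    rewrite -(sum_delta ord0 (fun x => Z s * T (t1 ++ x :: t2) * F (catrev s (t1 ++ t2)))).
    apply: eq_bigr => x _.
    rewrite !catrevE catA HG ?size_cat ?size_rev ?sn ?h1 ?h2 // -?catA; last lia.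
    by ring.
  + rewrite exchange_sumw; apply: sumw_eq0 => t st.
    have -> : n = ((n - i.+1) + i.+1)%N by lia.
    rewrite sumw_split1; apply: sumw_eq0 => s1 h1.
    apply: big1 => x _; apply: sumw_eq0 => s2 h2.
    have -> : catrev (s1 ++ x :: s2) t = rev s2 ++ x :: catrev s1 t.
      by rewrite !catrevE rev_cat !rev_cons -catA !cat_rcons.
    rewrite HG ?size_rev // ?size_cat;
      last by rewrite catrevE !size_cat !size_rev h1 h2 st; lia.
    case: eqP => [->|_]; last by rewrite mul0r mulr0.
    by case: jwZ => _ Z2; rewrite Z2 ?mul0r // size_cat h1 h2; lia.
Qed.
End JonesWenzl.

(** * Vectors of Motzkin paths *)

(* Motzkin paths written from the last step to the first one. *)
Inductive motzw : nat -> nat -> seq int -> Prop :=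
| MotzNil : motzw 0 0 [::]
| MotzUp k r p : motzw k r p -> motzw k.+1 r.+1 (1 :: p)
| MotzFlat k r p : motzw k r p -> motzw k.+1 r (0 :: p)
| MotzDown k r p : motzw k r.+1 p -> motzw k.+1 r (-1 :: p).

Lemma motzwS k r w : motzw k.+1 r w ->
  [\/ exists2 p, w = 1 :: p & exists2 r', r = r'.+1 & motzw k r' p,
      exists2 p, w = 0 :: p & motzw k r p |
      exists2 p, w = -1 :: p & motzw k r.+1 p].
Proof.
move E : k.+1 => k' pw; case: pw E => // {}k' {}r p pw [->].
- by constructor 1; exists p => //; exists r.
- by constructor 2; exists p.
- by constructor 3; exists p.
Qed.

Lemma motzw0 r w : motzw 0 r w -> r = 0%N /\ w = [::].
Proof. by move E : 0%N => k pw; case: pw E. Qed.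

Section Colourings.
Variable M : nat.
Notation C := 'I_M.+1.

(* [c] colours the columns, listed from right to left like the steps of [p], and
   [s] is the stack of colours of the white vertices, the rightmost one on top. *)
Fixpoint compat (p : seq int) (c s : seq C) : bool :=
  match p, c with
  | [::], [::] => s == [::]
  | a :: p', e :: c' =>
      if a == 1 then (if s is h :: s' then (h == e) && compat p' c' s' else false)
      else if a == 0 then (e == ord0) && compat p' c' s
      else compat p' c' (e :: s)
  | _, _ => false
  end.

Variable R : comNzRingType.

Definition wvec (p : seq int) (s c : seq C) : R := (compat p c s)%:R.

Lemma wvecU p h s e c : wvec (1 :: p) (h :: s) (e :: c) = (h == e)%:R * wvec p s c.
Proof. by rewrite /wvec /=; case: eqP; rewrite /= ?mul1r ?mul0r. Qed.

Lemma wvecZ p s e c : wvec (0 :: p) s (e :: c) = (e == ord0)%:R * wvec p s c.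
Proof. by rewrite /wvec /=; case: eqP; rewrite /= ?mul1r ?mul0r. Qed.

Lemma wvecD p s e c : wvec (-1 :: p) s (e :: c) = wvec p (e :: s) c.
Proof. by []. Qed.

Lemma wvec_nil a p s : wvec (a :: p) s [::] = 0. Proof. by []. Qed.

Definition wform k p q s t : R := sumw k (fun c => wvec p s c * wvec q t c).

Lemma wformC k p q s t : wform k p q s t = wform k q p t s.
Proof. by apply: eq_sumw => c _; rewrite mulrC. Qed.

Lemma wformS k p q s t : wform k.+1 p q s t =
  \sum_e sumw k (fun c => wvec p s (e :: c) * wvec q t (e :: c)).
Proof. by []. Qed.

Lemma wformUU k p q h s h' t :
  wform k.+1 (1 :: p) (1 :: q) (h :: s) (h' :: t) = (h == h')%:R * wform k p q s t.
Proof.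
rewrite wformS -(sum_delta h (fun e => (e == h')%:R * wform k p q s t)).
apply: eq_bigr => e _; rewrite mulrA -sumwZ; apply: eq_sumw => c _.
by rewrite !wvecU [h == e]eq_sym [h' == e]eq_sym; ring.
Qed.

Lemma wformUZ k p q h s t :
  wform k.+1 (1 :: p) (0 :: q) (h :: s) t = (h == ord0)%:R * wform k p q s t.
Proof.
rewrite wformS -(sum_delta h (fun e => (e == ord0)%:R * wform k p q s t)).
apply: eq_bigr => e _; rewrite mulrA -sumwZ; apply: eq_sumw => c _.
by rewrite wvecU wvecZ [h == e]eq_sym; ring.
Qed.

Lemma wformUD k p q h s t :
  wform k.+1 (1 :: p) (-1 :: q) (h :: s) t = wform k p q s (h :: t).
Proof.
rewrite wformS -(sum_delta h (fun e => wform k p q s (e :: t))).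
apply: eq_bigr => e _; rewrite -sumwZ; apply: eq_sumw => c _.
by rewrite wvecU wvecD [h == e]eq_sym; ring.
Qed.

Lemma wformZZ k p q s t : wform k.+1 (0 :: p) (0 :: q) s t = wform k p q s t.
Proof.
rewrite wformS -(sum_delta (ord0 : C) (fun=> wform k p q s t)).
apply: eq_bigr => e _; rewrite -sumwZ; apply: eq_sumw => c _.
by rewrite !wvecZ; case: (_ == _); rewrite ?mul1r ?mul0r.
Qed.

Lemma wformZD k p q s t :
  wform k.+1 (0 :: p) (-1 :: q) s t = wform k p q s (ord0 :: t).
Proof.
rewrite wformS -(sum_delta (ord0 : C) (fun e => wform k p q s (e :: t))).
apply: eq_bigr => e _; rewrite -sumwZ; apply: eq_sumw => c _.
by rewrite wvecZ wvecD; ring.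
Qed.

Lemma wformDD k p q s t :
  wform k.+1 (-1 :: p) (-1 :: q) s t = \sum_e wform k p q (e :: s) (e :: t).
Proof. by []. Qed.

(** Undoes [catrev]: a function of two stacks becomes one tensor whose middle slots are the two
    tops. *)
Definition glue (f : seq C -> seq C -> R) n z := f (rev (take n z)) (drop n z).

Lemma glueE f n z1 z2 : size z1 = n -> glue f n (z1 ++ z2) = f (rev z1) z2.
Proof. by move=> h; rewrite /glue take_size_cat // drop_size_cat. Qed.

Lemma glueS f n z1 x z2 : size z1 = n ->
  glue f n.+1 (z1 ++ x :: z2) = f (x :: rev z1) z2.
Proof. by move=> h; rewrite -cat_rcons glueE ?rev_rcons // size_rcons h. Qed.

Lemma glue_catrev f n s t : size s = n -> glue f n (catrev s t) = f s t.
Proof. by move=> h; rewrite catrevE glueE ?revK // size_rev. Qed.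

(** By the two last steps: up with up creates a cup in the middle, up with flat a dot; up with down
    moves the border between the stacks by one slot; flat with down sets a slot to 0; down with down
    contracts the two new tops; flat with flat changes nothing. *)
Lemma wform_planar k p q n m : motzw k n p -> motzw k m q ->
  planar (n + m) (glue (wform k p q) n).
Proof.
elim: k p q n m => [|k IH] p q n m.
  by move=> /motzw0[-> ->] /motzw0[-> ->]; exact: PlanarNil.
case/motzwS=> [[{}p -> [n' -> pn]]|[{}p -> pn]|[{}p -> pn]]
  /motzwS[[{}q -> [m' -> qm]]|[{}q -> qm]|[{}q -> qm]];
  have pF := IH _ _ _ _ pn qm.
- rewrite addSn addnS; apply: (PlanarCup pF (i := n')) => [|z1 z2 x y h1 _]; first lia.
  by rewrite glueS // glueE // wformUU.
- rewrite addSn; apply: (PlanarDot pF (i := n')) => [|z1 z2 x h1 _]; first lia.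
  by rewrite glueS // glueE // wformUZ.
- rewrite addSnnS; apply: (planar_ext pF) => z sz.
  have [|a [[|y b] [ez sa]]] := @split_at _ z n'; first lia.
    by move: (congr1 size ez); lsize.
  by rewrite ez glueS // glueE // wformUD.
- rewrite addnS; apply: (PlanarDot pF (i := n)) => [|z1 z2 x h1 _]; first lia.
  by rewrite !glueE // wformC wformUZ wformC.
- apply: (planar_ext pF) => z sz.
  have [|a [b [-> sa]]] := @split_at _ z n; first lia.
  by rewrite !glueE // wformZZ.
- apply: (planar_cap0 pF (i := n)) => [||z1 z2 h1 _]; try lia.
  by rewrite !glueE // wformZD.
- rewrite -addSnnS; apply: (planar_ext pF) => z sz.
  have [|a [[|y b] [ez sa]]] := @split_at _ z n; first lia.
    by move: (congr1 size ez); lsize.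
  by rewrite ez glueS // glueE // wformC wformUD wformC.
- apply: (planar_cap0 pF (i := n)) => [||z1 z2 h1 _]; try lia.
  by rewrite glueS // glueE // wformC wformZD wformC.
- apply: (planar_cap pF (i := n)) => [||z1 z2 h1 _]; try lia.
  rewrite glueE // wformDD; apply: eq_bigr => x _.
  by rewrite glueS.
Qed.

Lemma wform_jw k p q n m : motzw k n p -> motzw k m q -> (m <= n)%N ->
  exists beta, forall Z T, jw n Z ->
    sumw n (fun s => sumw m (fun t => Z s * T t * wform k p q s t)) =
    if m == n then beta * sumw n (fun s => Z s * T s) else 0.
Proof.
move=> pn qm mn; have [beta H] := planar_jw (wform_planar pn qm).
exists beta => Z T jZ; rewrite -H //.
by apply: eq_sumw => s sn; apply: eq_sumw => t tm; rewrite glue_catrev.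
Qed.

(** Two neighbouring white vertices are joined by an edge when the later of the two up steps is
    turned into a down step. On the way to it the depth [d] grows at a down step, which pushes a
    slot, and shrinks at an up step, which pops one. *)
Lemma wvec_join k N p : motzw k N p -> forall d, (d.+2 <= N)%N ->
  exists2 q, motzw k N.-2 q &
    forall c l T, size l = d -> wvec q (l ++ T) c = \sum_x wvec p (l ++ x :: x :: T) c.
Proof.
elim=> {k N p} [//|k N p pw IH|k N p pw IH|k N p pw IH] d dN.
- case: d dN => [|d] dN.
    exists (-1 :: p); first by apply: MotzDown; case: N pw dN {IH}.
    move=> [|e c] l T /size0nil-> /=; first by rewrite wvec_nil big1.
    rewrite wvecD -(sum_delta e (fun x => wvec p (x :: T) c)).
    by apply: eq_bigr => x _; rewrite wvecU.
  have [|q qw Hq] := IH d; first lia.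
  exists (1 :: q); first by case: N dN {IH pw} qw => [|[|N]] // dN qw; apply: MotzUp.
  move=> [|e c] [|h l] T //= [ld]; first by rewrite wvec_nil big1.
  by rewrite wvecU Hq // mulr_sumr; apply: eq_bigr => x _; rewrite wvecU.
- have [|q qw Hq] := IH d; first lia.
  exists (0 :: q); first exact: MotzFlat.
  move=> [|e c] l T ld; first by rewrite wvec_nil big1.
  by rewrite wvecZ Hq // mulr_sumr; apply: eq_bigr => x _; rewrite wvecZ.
- have [|q qw Hq] := IH d.+1; first lia.
  exists (-1 :: q); first by apply: MotzDown; case: N dN qw {IH pw} => [|[|N]].
  move=> [|e c] l T ld; first by rewrite wvec_nil big1.
  by rewrite wvecD -cat_cons Hq //= ld.
Qed.

(** The white up step at depth [d] becomes a flat step, which forces its column to the colour 0. *)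
Lemma wvec_dot k N p : motzw k N p -> forall d, (d < N)%N ->
  exists2 q, motzw k N.-1 q &
    forall c l T, size l = d -> wvec q (l ++ T) c = wvec p (l ++ ord0 :: T) c.
Proof.
elim=> {k N p} [//|k N p pw IH|k N p pw IH|k N p pw IH] d dN.
- case: d dN => [|d] dN.
    exists (0 :: p); first exact: MotzFlat.
    move=> [|e c] l T /size0nil-> //=; by rewrite wvecZ wvecU eq_sym.
  have [|q qw Hq] := IH d; first lia.
  exists (1 :: q); first by case: N dN {IH pw} qw => [|N] // dN qw; apply: MotzUp.
  by move=> [|e c] [|h l] T //= [ld]; rewrite !wvecU Hq.
- have [|q qw Hq] := IH d; first lia.
  exists (0 :: q); first exact: MotzFlat.
  by move=> [|e c] l T ld //; rewrite !wvecZ Hq.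
- have [|q qw Hq] := IH d.+1; first lia.
  exists (-1 :: q); first by apply: MotzDown; case: N dN qw {IH pw} => [|N].
  by move=> [|e c] l T ld //; rewrite !wvecD -cat_cons Hq //= ld.
Qed.

End Colourings.

(** * Explicit Jones-Wenzl vectors over the label word *)

Section Elimination.
Variables (R : fieldType) (M : nat).
Notation C := 'I_M.+1.
Notation y := (M%:R : R).
Notation wvec := (wvec (M := M) R).
Notation wform := (wform (M := M) R).
Implicit Types (s t l : seq C) (c : seq C).

(** The labels of the white vertices, top of the stack first. For [r <= M] they are distinct and
    nonzero; beyond that [inord] would fall back to 0. *)
Fixpoint std r : seq C := if r is r'.+1 then inord r :: std r' else [::].

Lemma size_std r : size (std r) = r. Proof. by elim: r => //= r ->. Qed.

Lemma mem_std r (x : C) : (r <= M)%N -> x \in std r -> (0 < x <= r)%N.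
Proof.
elim: r => //= r IH rM; rewrite inE => /orP[/eqP->|/IH]; last by lia.
by rewrite inordK /=.
Qed.

Lemma uniq_std r : (r <= M)%N -> uniq (std r).
Proof.
elim: r => //= r IH rM; rewrite IH ?(ltnW rM) // andbT; apply/negP => /mem_std.
by rewrite inordK // ltnn andbF => /(_ (ltnW rM)).
Qed.

Lemma std_cap r s1 s2 x : (r <= M)%N -> (s1 ++ x :: x :: s2 == std r) = false.
Proof.
move=> /uniq_std u; apply/eqP => e; move: u.
by rewrite -e cat_uniq /= inE eqxx /= !andbF.
Qed.

Lemma std_dot r s1 s2 : (r <= M)%N -> (s1 ++ ord0 :: s2 == std r) = false.
Proof.
move=> rM; apply/eqP => e.
have := @mem_std r ord0 rM; rewrite -e mem_cat inE eqxx orbT => /(_ isT).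
by [].
Qed.

Lemma jw_std r : (r <= M)%N -> jw r (fun s => (s == std r)%:R : R).
Proof.
move=> rM; split=> s1 s2 _; last by rewrite std_dot.
by rewrite big1 // => x _; rewrite std_cap.
Qed.

(** The continued fraction of [u_(r+1) / u_r] at [M]. It arises as the sum of
    [jwvec r e (e :: std r)] over the nonzero colours [e]. *)
Fixpoint rho r : R := if r is r'.+1 then y - (rho r')^-1 else y.
Definition kap r : R := if r is r'.+1 then (rho r')^-1 else 0.

Lemma rhoE r : rho r = y - kap r.
Proof. by case: r => //=; rewrite subr0. Qed.

(* A combination of the vectors obtained from [std r.-1] by inserting two equal
   colours in neighbouring slots. The coefficients make [inord r :: std r] minus
   [jwtail r] a Jones-Wenzl vector; the recursion separates the pair inserted on
   top from the pairs inserted deeper. *)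
Fixpoint jwtail r s : R :=
  if r is r'.+1 then
    if s is a :: b :: s' then
      kap r * ([&& a == b, a != ord0 & s' == std r']%:R
               - (a == inord r')%:R * jwtail r' (b :: s'))
    else 0
  else 0.

Lemma jwtail_top r s : (r <= M)%N ->
  jwtail r (inord r :: s) = kap r * (s == std r)%:R.
Proof.
case: r => [|r] rM /=; first by rewrite mul0r.
case: s => [|b s] /=; first by rewrite mulr0.
have -> : (inord r.+1 == inord r :> C) = false.
  by apply/eqP => /(congr1 val); rewrite /= !inordK //; lia.
have -> : inord r.+1 != ord0 :> C by apply/eqP => /(congr1 val); rewrite /= inordK.
by rewrite mul0r subr0 eqseq_cons [b == _]eq_sym.
Qed.

Lemma sum_nonzero : \sum_(x : C) (x != ord0)%:R = y.
Proof.
rewrite (bigD1 ord0) //= add0r (eq_bigr (fun=> 1)) => [|x ->] //.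
by rewrite (eq_bigl [in predC1 (ord0 : C)]) // sumr_const cardC1 card_ord.
Qed.

(** This is where the recursion for [rho] comes from: the pair on top contributes [M], the deeper
    pairs subtract [kap r], and [kap r.+1 * rho r = 1]. *)
Lemma jwtail_cap_top r s : (r < M)%N -> rho r != 0 ->
  \sum_x jwtail r.+1 (x :: x :: s) = (s == std r)%:R.
Proof.
move=> rM rho0 /=.
under eq_bigr => x _ do rewrite eqxx /=.
rewrite -mulr_sumr sumrB sum_delta jwtail_top 1?ltnW //.
have -> : \sum_(x : C) ((x != ord0) && (s == std r))%:R = y * (s == std r)%:R.
  rewrite -sum_nonzero mulr_suml; apply: eq_bigr => x _.
  by case: (x == ord0); rewrite /= ?mul1r ?mul0r.
by rewrite -mulrBl -rhoE mulrA mulVf // mul1r.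
Qed.

(** Just below the top, the pair on top straightens to a single word, which cancels the contraction
    of the deeper pairs given by [jwtail_cap_top]. Further down the pair on top contributes nothing,
    as [std] has no equal neighbours, and the rest is the induction hypothesis. *)
Lemma jwtail_cap r a s1 s2 : (r < M)%N -> (forall i, (i < r)%N -> rho i != 0) ->
  \sum_x jwtail r (a :: s1 ++ x :: x :: s2) = 0.
Proof.
elim: r a s1 => [|r IH] a s1 rM rho0; first by rewrite big1.
have hr : \sum_x jwtail r (a :: s1 ++ x :: x :: s2) = 0.
  by apply: IH => [|i ir]; [lia | apply: rho0; lia].
case: s1 hr => [|b s1] hr.
  rewrite /= -mulr_sumr sumrB -mulr_sumr.
  have -> : \sum_(x : C) [&& a == x, a != ord0 & x :: s2 == std r]%:R =
      ((a != ord0) && (a :: s2 == std r))%:R :> R.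
    rewrite -(sum_delta a (fun x => ((a != ord0) && (x :: s2 == std r))%:R)).
    by apply: eq_bigr => x _; rewrite eq_sym; case: (x == a); rewrite /= ?mul1r ?mul0r.
  case: r IH rM rho0 hr => [|r] IH rM rho0 hr.
    by rewrite big1 // andbF mulr0 subrr mulr0.
  rewrite jwtail_cap_top ?rho0 //; try lia.
  rewrite /= eqseq_cons; case: (a =P inord r.+1) => [->|_] /=; last first.
    by rewrite andbF mul0r subrr mulr0.
  have -> : inord r.+1 != ord0 :> C.
    by apply/eqP => /(congr1 val); rewrite /= inordK //; lia.
  by rewrite mul1r subrr mulr0.
rewrite /= -mulr_sumr sumrB -mulr_sumr [X in _ - _ * X]IH; last 2 first.
- lia.
- by move=> i ir; apply: rho0; lia.
rewrite mulr0 subr0 big1 ?mulr0 // => x _.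
by rewrite std_cap ?andbF //; lia.
Qed.

Lemma jwtail_dot r s1 s2 : (r <= M)%N -> jwtail r (s1 ++ ord0 :: s2) = 0.
Proof.
elim: r s1 s2 => [//|r IH] s1 s2 rM.
have [] : (r <= M)%N /\ ord0 != inord r.+1 :> C.
  split; first lia.
  by apply/eqP => /(congr1 val); rewrite /= inordK.
case: s1 => [|a [|b s1]] rM' h /=.
- case: s2 => [//|b s2]; rewrite andbF.
  case: r {h} rM rM' IH => [|r] rM rM' IH; first by rewrite mulr0 subrr mulr0.
  suff -> : (ord0 == inord r.+1 :> C) = false by rewrite mul0r subrr mulr0.
  by apply/eqP => /(congr1 val); rewrite /= inordK.
- by rewrite (IH [::]) // mulr0 subr0 andbA andbN mulr0.
- by rewrite (IH (b :: s1)) // mulr0 subr0 std_dot // !andbF mulr0.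
Qed.

(** For nonzero [d] other than the top label, [d :: std r] has neither equal neighbours nor a 0, so
    its indicator needs no correction. For [r = 0] the test reads [d = 0] and [jwtail 0] is 0. *)
Definition jwvec r d s : R :=
  (s == d :: std r)%:R - (d == inord r)%:R * jwtail r s.

Lemma jw_jwvec r d : (r < M)%N -> (forall i, (i < r)%N -> rho i != 0) ->
  d != ord0 -> jw r.+1 (jwvec r d).
Proof.
move=> rM rho0 d0; split=> s1 s2 _.
  rewrite sumrB -mulr_sumr; case: s1 => [|a s1] /=.
    transitivity ((d :: s2 == std r)%:R - (d == inord r)%:R *
      \sum_x jwtail r (x :: x :: s2)).
      congr (_ - _); rewrite -(sum_delta d (fun x => (x :: s2 == std r)%:R)).
      by apply: eq_bigr => x _; rewrite eqseq_cons; case: (x == d);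
        rewrite /= ?mul1r ?mul0r.
    case: r rM rho0 => [|r] rM rho0; first by rewrite big1 // mulr0 subrr.
    rewrite jwtail_cap_top ?rho0 //; last lia.
    by rewrite /= eqseq_cons; case: (d =P _); rewrite /= ?mul1r ?mul0r subrr.
  rewrite jwtail_cap // mulr0 subr0 big1 // => x _.
  by rewrite eqseq_cons std_cap ?andbF // ltnW.
rewrite /jwvec jwtail_dot 1?ltnW // mulr0 subr0; case: s1 => [|a s1] /=.
  by rewrite eqseq_cons eq_sym (negPf d0).
by rewrite eqseq_cons std_dot ?andbF // ltnW.
Qed.

End Elimination.

(** * Gram determinants *)

Section LinearSpan.
Variable R : fieldType.

(** Finite linear combinations with equality taken pointwise, since the vectors are functions on
    words or on paths. *)
Inductive lspan (X : Type) (G : (X -> R) -> Prop) : (X -> R) -> Prop :=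
| LSpan0 h : (forall x, h x = 0) -> lspan G h
| LSpanC a g h f : G g -> lspan G h -> (forall x, f x = a * g x + h x) -> lspan G f.

Lemma lspan_comb X (G : (X -> R) -> Prop) a g b h f :
  lspan G g -> lspan G h -> (forall x, f x = a * g x + b * h x) -> lspan G f.
Proof.
move=> sg sh; elim: sg f => {g} [g g0|a' g1 g2 g Gg1 _ IH gE] f.
  elim: sh f => {h} [h h0|a' h1 h2 h Gh1 _ IH hE] f fE.
    by apply: LSpan0 => x; rewrite fE g0 h0 !mulr0 addr0.
  apply: (LSpanC (a := b * a') Gh1 (h := fun x => a * g x + b * h2 x)).
    exact: IH.
  by move=> x; rewrite fE hE; ring.
move=> fE; apply: (LSpanC (a := a * a') Gg1 (h := fun x => a * g2 x + b * h x)).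
  exact: IH.
by move=> x; rewrite fE gE; ring.
Qed.

Lemma lspan_gen X (G : (X -> R) -> Prop) g f :
  G g -> (forall x, f x = g x) -> lspan G f.
Proof.
move=> Gg fE; apply: (LSpanC (a := 1) Gg (h := fun=> 0)); first exact: LSpan0.
by move=> x; rewrite fE mul1r addr0.
Qed.

Lemma lspan_ext X (G : (X -> R) -> Prop) g f :
  lspan G g -> (forall x, f x = g x) -> lspan G f.
Proof.
move=> Gg fE; apply: (lspan_comb (a := 1) (b := 0) Gg Gg) => x.
by rewrite fE mul1r mul0r addr0.
Qed.

Lemma lspan_map X Y (G : (X -> R) -> Prop) (G' : (Y -> R) -> Prop)
    (L : (X -> R) -> Y -> R) g :
  (forall h, (forall x, h x = 0) -> forall z, L h z = 0) ->
  (forall a g h f, (forall x, f x = a * g x + h x) -> forall z, L f z = a *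
    L g z + L h z) ->
  (forall g, G g -> lspan G' (L g)) -> lspan G g -> lspan G' (L g).
Proof.
move=> L0 LC LG; elim=> {g} [h h0|a g h f Gg _ IH fE]; first by apply: LSpan0; apply: L0.
by apply: (lspan_comb (a := a) (b := 1) (LG _ Gg) IH) => z; rewrite (LC _ _ _ _ fE) mul1r.
Qed.

Variable T : eqType.
Variable x0 : T.
Implicit Types (f g : T -> T -> R) (S : seq T).

Definition gram n f S : 'M[R]_n := \matrix_(i, j) f (nth x0 S i) (nth x0 S j).

Lemma det_gram_perm n f S S' : size S = n -> perm_eq S S' ->
  \det (gram n f S) = \det (gram n f S').
Proof.
move=> Sn SS'; have S'n : size S' == n by rewrite -(perm_size SS') Sn.
have /tuple_permP[p Sp] : perm_eq S (Tuple S'n) by [].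
have -> : gram n f S = row_perm p (col_perm p (gram n f S')).
  apply/matrixP => i j; rewrite !mxE Sp.
  by rewrite -!(tnth_nth x0 [tuple tnth (Tuple S'n) (p i) | i < n]) !tnth_mktuple !(tnth_nth x0).
rewrite row_permE col_permE !det_mulmx !det_perm.
by rewrite mulrC -mulrA -signr_addb odd_permV addbb mulr1.
Qed.

(** Row elimination: subtracting combinations of the upper rows turns the lower rows into [(0, g)],
    so the Gram matrix is a unipotent lower triangular block matrix times an upper triangular one.
    Here [g] pairs modified rows with unmodified columns. *)
Lemma det_gram_cat n1 n2 f g S1 S2 : size S1 = n1 -> size S2 = n2 ->
  (forall s z, s \in S2 -> z \in S1 -> g s z = 0) ->
  (forall s, s \in S2 ->
     lspan (fun h => exists2 e, e \in S1 & forall z, h z = f e z)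
           (fun z => f s z - g s z)) ->
  \det (gram (n1 + n2) f (S1 ++ S2)) = \det (gram n1 f S1) * \det (gram n2 g S2).
Proof.
move=> s1 s2 g0 fg; pose F := gram (n1 + n2) f (S1 ++ S2).
pose V (h : T -> R) : 'rV[R]_(n1 + n2) := \row_j h (nth x0 (S1 ++ S2) j).
have nthl (i : 'I_n1) : nth x0 (S1 ++ S2) (lshift n2 i) = nth x0 S1 i.
  by rewrite nth_cat /= s1 ltn_ord.
have nthr (i : 'I_n2) : nth x0 (S1 ++ S2) (rshift n1 i) = nth x0 S2 i.
  by rewrite nth_cat /= s1 ltnNge leq_addr addKn.
have inS1 (i : 'I_n1) : nth x0 S1 i \in S1 by rewrite mem_nth ?s1.
have inS2 (i : 'I_n2) : nth x0 S2 i \in S2 by rewrite mem_nth ?s2.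
have Vspan h : lspan (fun h => exists2 e, e \in S1 & forall z, h z = f e z) h ->
    (V h <= usubmx F)%MS.
  elim=> {h} [h h0|a g1 g2 h [e eS gE] _ IH hE].
    by rewrite (_ : V h = 0) ?sub0mx //; apply/rowP => j; rewrite !mxE h0.
  rewrite (_ : V h = a *: V g1 + V g2); last by apply/rowP => j; rewrite !mxE hE.
  apply: addmx_sub => //; apply: scalemx_sub.
  have ei : (index e S1 < n1)%N by rewrite -s1 index_mem.
  rewrite (_ : V g1 = row (Ordinal ei) (usubmx F)) ?row_sub //.
  by apply/rowP => j; rewrite !mxE nthl /= nth_index // gE.
have : (dsubmx F - row_mx 0 (gram n2 g S2) <= usubmx F)%MS.
  apply/row_subP => i.
  rewrite (_ : row _ _ = V (fun z => f (nth x0 S2 i) z - g (nth x0 S2 i) z)).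
    exact/Vspan/fg.
  apply/rowP => j; rewrite !mxE nthr; congr (_ - _).
  by case: split_ordP => l ->; rewrite mxE ?nthl ?nthr // g0.
case/submxP => X HX.
have -> : gram (n1 + n2) f (S1 ++ S2) =
    block_mx 1%:M 0 X 1%:M *m block_mx (gram n1 f S1) (ursubmx F) 0 (gram n2 g S2).
  rewrite -/F -{1}[F]submxK mulmx_block !mul1mx !mul0mx !addr0.
  have ul : ulsubmx F = gram n1 f S1 by apply/matrixP => i j; rewrite !mxE !nthl.
  have: dsubmx F = X *m usubmx F + row_mx 0 (gram n2 g S2) by rewrite -HX subrK.
  rewrite -[dsubmx F]hsubmxK -[usubmx F]hsubmxK mul_mx_row add_row_mx addr0.
  by case/eq_row_mx => e1 e2; rewrite -ul; congr block_mx.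
by rewrite det_mulmx det_lblock det_ublock !det1 !mul1r.
Qed.

End LinearSpan.

Fixpoint paths (k r : nat) : seq (seq int) :=
  if k is k'.+1 then
    ((if r is r'.+1 then map (cons 1) (paths k' r') else [::])
     ++ map (cons 0) (paths k' r)) ++ map (cons (-1)) (paths k' r.+1)
  else if r is 0%N then [:: [::]] else [::].

Lemma pathsP k r p : reflect (motzw k r p) (p \in paths k r).
Proof.
apply: (iffP idP) => [|]; last first.
  elim=> {k r p} [//|k r p _ IH|k r p _ IH|k r p _ IH] /=; rewrite !mem_cat.
  - by rewrite map_f.
  - by rewrite map_f ?orbT.
  - by rewrite map_f ?orbT.
elim: k r p => [|k IH] r p /=.
  by case: r => [|r] //; rewrite inE => /eqP->; constructor.
rewrite !mem_cat => /orP[/orP[|]|].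
- by case: r => // r /mapP[q /IH qw ->]; constructor.
- by move=> /mapP[q /IH qw ->]; constructor.
- by move=> /mapP[q /IH qw ->]; constructor.
Qed.

(** * Projecting the paths that end in a down step *)

Section Recursion.
Variables (R : fieldType) (M : nat).
Notation C := 'I_M.+1.
Notation wvec := (wvec (M := M) R).
Notation wform := (wform (M := M) R).
Notation std := (std M).
Notation rho := (rho R M).
Notation kap := (kap R M).
Notation jwtail := (jwtail R (M := M)).
Notation jwvec := (jwvec R (M := M)).

Lemma sumw_delta_wvec n s0 (f : seq C -> R) : size s0 = n ->
  sumw n (fun s => f s * (s == s0)%:R) = f s0.
Proof.
by move=> h; rewrite -(sumw_delta f h); apply: eq_sumw => s _; rewrite mulrC.
Qed.

(** The scalar of the planar pairing is identified by testing it on the indicator of [std n], which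
    is itself a Jones-Wenzl vector. *)
Lemma wform_jw_std k p q n m Z t : (n <= M)%N -> (m <= n)%N ->
  motzw k n p -> motzw k m q -> jw n Z -> size t = m ->
  sumw k (fun c => sumw n (fun s => Z s * wvec p s c) * wvec q t c) =
  if m == n then wform k p q (std n) (std n) * Z t else 0.
Proof.
move=> nM mn pn qm jZ tm; have [beta H] := @wform_jw M R _ _ _ _ _ pn qm mn.
have E Z' t' : size t' = m -> jw n Z' ->
    sumw n (fun s => Z' s * wform k p q s t') = if m == n then beta * Z' t' else 0.
  move=> tm' jZ'; have := H Z' (fun s => (s == t')%:R) jZ'.
  have -> : sumw n (fun s => sumw m (fun t => Z' s * (t == t')%:R * wform k p q s t)) =
      sumw n (fun s => Z' s * wform k p q s t').
    apply: eq_sumw => s sn; rewrite -(sumw_delta (fun t => Z' s * wform k p q s t) tm').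
    by apply: eq_sumw => t'' _; ring.
  by move=> ->; case: (m =P n) => // mn'; rewrite sumw_delta_wvec // -mn'.
have -> : sumw k (fun c => sumw n (fun s => Z s * wvec p s c) * wvec q t c) =
    sumw n (fun s => Z s * wform k p q s t).
  under eq_sumw => c _ do rewrite -sumwZr.
  rewrite exchange_sumw; apply: eq_sumw => s _; rewrite -sumwZ.
  by apply: eq_sumw => c _; rewrite mulrA.
rewrite E //; case: (m =P n) => // mn'; congr (_ * _).
have := E _ (std n) _ (jw_std R nM); rewrite mn' eqxx eqxx mulr1 => <-;
  last exact: size_std.
by rewrite (sumw_delta (fun s => wform k p q s (std n)) (size_std M n)).
Qed.

(** The words of [jwtail r] are [std r.-1] with an equal pair inserted, and summing over the pair
    joins two white vertices of [p]. Since the pair on top ranges over nonzero colours, the term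
    with two dots is subtracted. The prefix [l] collects the labels above the pair as the recursion
    goes deeper. *)
Lemma wvec_jwtail_span k p l r : (r <= M)%N -> motzw k (size l + r.+1) p ->
  lspan (fun g => exists2 q, (0 < r)%N /\ motzw k (size l + r.-1) q &
                  forall c, g c = wvec q (l ++ std r.-1) c)
        (fun c => sumw r.+1 (fun s => jwtail r s * wvec p (l ++ s) c)).
Proof.
elim: r l => [|r IH] l rM pw.
  by apply: LSpan0 => c; apply: sumw_eq0 => s _; rewrite mul0r.
have [|q1 q1w Hq1] := @wvec_join M R _ _ _ pw (size l); first lia.
have [|q q0w Hq0] := @wvec_dot M R _ _ _ pw (size l); first lia.
have [|q2 q2w Hq2] := @wvec_dot M R _ _ _ q0w (size l); first lia.
have IH' := IH (rcons l (inord r)) (ltnW rM).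
rewrite size_rcons addSnnS in IH'; have {IH'} sp := IH' pw.
have gen q' : motzw k (size l + r) q' ->
    lspan (fun g => exists2 q, (0 < r.+1)%N /\ motzw k (size l + r) q &
                  forall c, g c = wvec q (l ++ std r) c) (wvec q' (l ++ std r)).
  by move=> qw; apply: (@lspan_gen _ _ _ (wvec q' (l ++ std r))) => //; exists q'.
have cap : lspan (fun g => exists2 q, (0 < r.+1)%N /\ motzw k (size l + r) q &
      forall c, g c = wvec q (l ++ std r) c)
    (fun c => \sum_(x : C) (x != ord0)%:R * wvec p (l ++ x :: x :: std r) c).
  apply: (lspan_comb (a := 1) (b := -1) (gen q1 _) (gen q2 _)).
  - by move: q1w; rewrite !addnS.
  - by move: q2w; rewrite !addnS.
  move=> c; rewrite Hq1 // Hq2 // Hq0 //.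
  rewrite [in RHS](bigD1 ord0) //= (bigD1 ord0) //= mul0r add0r mul1r addrC mulN1r.
  rewrite [in RHS]addrC [X in _ = X - _]addrC addrK.
  by apply: eq_bigr => x ->; rewrite mul1r.
have tl : lspan (fun g => exists2 q, (0 < r.+1)%N /\ motzw k (size l + r) q &
      forall c, g c = wvec q (l ++ std r) c)
    (fun c => sumw r.+1 (fun s => jwtail r s * wvec p (rcons l (inord r) ++ s) c)).
  apply: (@lspan_map _ _ _ _ _ (fun h => h)) sp => // g [q' [r0 qw] gE].
  apply: (lspan_gen (g := g)) => //; exists q' => [|c].
    by split=> //; case: r r0 qw {IH pw Hq0 Hq1 Hq2 gen cap gE q0w q1w q2w rM} =>
      // r _; rewrite addSnnS.
  by rewrite gE cat_rcons; case: r r0 {IH pw Hq0 Hq1 Hq2 gen cap gE q0w q1w q2w rM qw}.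
apply: (lspan_comb (a := kap r.+1) (b := - kap r.+1) cap tl) => c.
rewrite mulNr -mulrBr sumwS.
transitivity (\sum_(a : C) kap r.+1 * ((a != ord0)%:R * wvec p (l ++ a :: a :: std r) c -
    (a == inord r)%:R * sumw r.+1 (fun s => jwtail r s * wvec p (l ++ a :: s) c))).
  apply: eq_bigr => a _.
  rewrite -(sumw_delta (fun s => wvec p (l ++ a :: s) c)
    (congr1 succn (size_std M r) : size (a :: std r) = r.+1)).
  rewrite -!sumwZ -sumwB -sumwZ; apply: eq_sumw => [[|b s]] // _.
  rewrite /= eqseq_cons [a == b]eq_sym.
  by case: (b == a); case: (a == ord0); case: (s == std r); rewrite /=; ring.
rewrite -mulr_sumr sumrB sum_delta; congr (_ * (_ - _)).
by apply: eq_sumw => s _; rewrite cat_rcons.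
Qed.

(* The vector of [-1 :: p] projected off the span of the words with head [0] or [1]. *)
Definition downvec r p (c : seq C) : R :=
  if c is e :: c' then
    (e != ord0)%:R * wvec p (e :: std r) c'
    - (e == inord r)%:R * sumw r.+1 (fun s => jwtail r s * wvec p s c')
  else 0.

(** At each first colour [e] the projected vector is [jwvec r e] carried through [p]. The factor for
    [e = 0] leaves the tail unchanged: [inord r] is nonzero for [r > 0], and [jwtail 0] vanishes. *)
Lemma downvecE r p e c : (r <= M)%N -> downvec r p (e :: c) =
  (e != ord0)%:R * sumw r.+1 (fun s => jwvec r e s * wvec p s c).
Proof.
move=> rM /=; rewrite -(sumw_delta (fun s => wvec p s c)
  (congr1 succn (size_std M r) : size (e :: std r) = r.+1)).
case: (e =P ord0) => [->|_] /=; last first.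
  rewrite !mul1r -sumwZ -sumwB; apply: eq_sumw => s _.
  by rewrite /jwvec mulrBl mulrA.
rewrite !mul0r sub0r; apply/eqP; rewrite oppr_eq0; apply/eqP.
case: r rM => [|r] rM; first by rewrite [X in _ * X]sumw_eq0 ?mulr0 // => s _;
  rewrite mul0r.
have -> : (ord0 == inord r.+1 :> C) = false by apply/eqP => /(congr1 val);
  rewrite /= inordK.
by rewrite mul0r.
Qed.

(** Only the first argument is projected, in accordance with row elimination. [behead] strips the
    final down step, which is built into [downvec]. *)
Definition downform k r (p q : seq int) : R :=
  sumw k (fun c => downvec r (behead p) c * wvec q (std r) c).

Definition cellform k r (p q : seq int) : R := wform k p q (std r) (std r).

(** Once the last steps are removed, a Jones-Wenzl vector on [r + 1] slots is paired with a stack of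
    [r - 1] slots. *)
Lemma downform_up k r p q : (r < M)%N -> (forall i, (i < r)%N -> rho i != 0) ->
  motzw k r.+1 p -> (0 < r)%N -> motzw k r.-1 q -> downform k.+1 r (-1 :: p) (1 :: q) = 0.
Proof.
case: r => // r rM rho0 pw _ qw; rewrite /downform sumwS.
transitivity (\sum_(e : C) (e == inord r.+1)%:R *
    sumw k (fun c => downvec r.+1 p (e :: c) * wvec q (std r) c)).
  apply: eq_bigr => e _; rewrite -sumwZ; apply: eq_sumw => c _.
  by rewrite wvecU [inord _ == e]eq_sym mulrCA.
rewrite sum_delta.
have r0 : inord r.+1 != ord0 :> C.
  by apply/eqP => /(congr1 val); rewrite /= inordK //; lia.
have rr : (r <= r.+2)%N by lia.
have := wform_jw_std rM rr pw qw (jw_jwvec rM rho0 r0) (size_std M r).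
rewrite (_ : (r == r.+2) = false) => [<-|]; last by apply/eqP; lia.
apply: eq_sumw => c _.
by rewrite (downvecE _ _ _ (ltnW rM)) r0 mul1r.
Qed.

Lemma downform_flat k r p q : (r <= M)%N ->
  downform k.+1 r (-1 :: p) (0 :: q) = 0.
Proof.
move=> rM; rewrite /downform sumwS big1 // => e _; apply: sumw_eq0 => c _.
rewrite [behead _]/= downvecE // wvecZ.
by case: (e == ord0); rewrite /= ?mul0r ?mulr0.
Qed.

(** Both stacks have [r + 1] slots, so only the value of [jwvec r e] at [e :: std r] enters; over
    nonzero [e] these values sum to [M - kap r = rho r]. *)
Lemma downform_down k r p q : (r < M)%N -> (forall i, (i < r)%N -> rho i != 0) ->
  motzw k r.+1 p -> motzw k r.+1 q ->
  downform k.+1 r (-1 :: p) (-1 :: q) = rho r * cellform k r.+1 p q.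
Proof.
move=> rM rho0 pw qw; rewrite /downform sumwS.
transitivity (\sum_(e : C) (e != ord0)%:R * (cellform k r.+1 p q * jwvec r e (e :: std r))).
  apply: eq_bigr => e _.
  transitivity (sumw k (fun c => (e != ord0)%:R *
      (sumw r.+1 (fun s => jwvec r e s * wvec p s c) * wvec q (e :: std r) c))).
    by apply: eq_sumw => c _; rewrite (downvecE _ _ _ (ltnW rM)) -mulrA.
  rewrite sumwZ; case e0: (e != ord0); last by rewrite !mul0r.
  have et : size (e :: std r) = r.+1 by rewrite /= size_std.
  have := wform_jw_std rM (leqnn _) pw qw (jw_jwvec rM rho0 e0) et.
  by rewrite eqxx => ->.
under eq_bigr => e _ do rewrite mulrCA.
rewrite -mulr_sumr mulrC; congr (_ * _).
rewrite /jwvec; under eq_bigr => e _ do rewrite eqxx mulrBr mulr1 mulrCA.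
rewrite sumrB sum_delta jwtail_top 1?ltnW // eqxx mulr1 rhoE; congr (_ - _).
  exact: sum_nonzero.
case: r rM {pw qw rho0} => [|r] rM; first by rewrite mulr0.
suff -> : inord r.+1 != ord0 :> C by rewrite mul1r.
by apply/eqP => /(congr1 val); rewrite /= inordK //; lia.
Qed.
End Recursion.

(** * The recursion for the Gram determinants *)

Section DeterminantRecursion.
Variables (R : fieldType) (M : nat).
Notation C := 'I_M.+1.
Notation wvec := (wvec (M := M) R).
Notation wform := (wform (M := M) R).
Notation std := (std M).
Notation rho := (rho R M).
Notation cellform := (cellform R M).
Notation downform := (downform R M).

Definition celldet k r : R :=
  \det (gram [::] (size (paths k r)) (cellform k r) (paths k r)).

Lemma gram_map n a (f g : seq int -> seq int -> R) S : size S = n ->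
  (forall p q, p \in S -> q \in S -> f (a :: p) (a :: q) = g p q) ->
  gram [::] n f (map (cons a) S) = gram [::] n g S.
Proof.
move=> Sn fg; apply/matrixP => i j; rewrite !mxE !(nth_map [::]) ?Sn //.
by rewrite fg // mem_nth // Sn.
Qed.

Definition upflat k r := (if r is r'.+1 then map (cons 1) (paths k r') else [::]) ++
                 map (cons 0) (paths k r).

(** The projection removes two pieces. The part with first colour 0 is a path ending in a flat step,
    by dotting the top slot of [p]. The part with first colour [inord r] is the tail, whose paths of
    rank [r - 1] receive a final up step. *)
Lemma downform_span k r p : (r < M)%N -> motzw k r.+1 p ->
  lspan (fun h => exists2 e, e \in upflat k r & forall z, h z = cellform k.+1 r e z)
        (fun z => cellform k.+1 r (-1 :: p) z - downform k.+1 r (-1 :: p) z).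
Proof.
move=> rM pw.
pose L (h : seq C -> R) (z : seq int) := sumw k.+1 (fun c => h c * wvec z (std r) c).
have [|q qw Hq] := @wvec_dot M R _ _ _ pw 0; first by [].
have := @wvec_jwtail_span R M k p [::] r (ltnW rM); rewrite add0n => /(_ pw) sp.
pose E (h : seq C -> R) (c : seq C) := if c is e :: c' then (e == inord r)%:R * h c' else 0.
have spE : lspan (fun g => exists2 e, e \in upflat k r & forall c, g c = wvec e (std r) c)
   (E (fun c => sumw r.+1 (fun s => jwtail R r s * wvec p s c))).
  apply: (lspan_map (L := E) _ _ _ sp) =>
    [h h0 [|e c]|a g h f fE [|e c]|g [q' [r0 q'w] gE]].
  - by [].
  - by rewrite /E h0 mulr0.
  - by rewrite /E mulr0 addr0.
  - by rewrite /E fE; ring.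
  apply: (lspan_gen (g := wvec (1 :: q') (std r))).
    exists (1 :: q') => //; rewrite mem_cat; apply/orP; left.
    by case: r r0 q'w {rM pw qw sp L E Hq gE} => // r _ q'w; apply/map_f/pathsP.
  case=> [|e c]; first by [].
  rewrite /E gE cat0s.
  have -> : std r = inord r :: std r.-1 by case: (r) r0.
  by rewrite wvecU [e == _]eq_sym.
have spV : lspan (fun g => exists2 e, e \in upflat k r & forall c, g c = wvec e (std r) c)
   (fun c => wvec (-1 :: p) (std r) c - downvec R r p c).
  apply: (lspan_comb (a := 1) (b := 1) (g := wvec (0 :: q) (std r)) _ spE).
    apply: (lspan_gen (g := wvec (0 :: q) (std r))) => //; exists (0 :: q) => //.
    by rewrite mem_cat; apply/orP; right; apply/map_f/pathsP.
  move=> [|e c]; first by rewrite /E wvec_nil subrr !mulr0 addr0.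
  rewrite wvecD wvecZ /downvec /E.
  have -> : wvec q (std r) c = wvec p (ord0 :: std r) c := Hq c [::] (std r) erefl.
  rewrite !mul1r opprB addrCA addrC; congr (_ + _).
  by case: (e =P ord0) => [->|_]; rewrite /= ?mul0r ?mul1r ?subr0 ?subrr.
have spL : lspan (fun h => exists2 e, e \in upflat k r &
  forall z, h z = cellform k.+1 r e z)
        (L (fun c => wvec (-1 :: p) (std r) c - downvec R r p c)).
  apply: (lspan_map (L := L) _ _ _ spV) => [h h0 z|a g h f fE z|g [e eS gE]].
  - by apply: sumw_eq0 => c _; rewrite h0 mul0r.
  - by rewrite /L -sumwZ -sumwD; apply: eq_sumw => c _; rewrite fE; ring.
  apply: (lspan_gen (g := L g)) => //; exists e => // z.
  by apply: eq_sumw => c _; rewrite gE.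
apply: (lspan_ext spL) => z.
by rewrite /L /cellform /wform /downform -sumwB; apply: eq_sumw => c _; rewrite mulrBl.
Qed.

(** Two block eliminations. The first separates the projected down rows. In the second the up and
    flat blocks are already orthogonal, since a common colouring would give the top label the colour
    0. *)
Lemma celldetS k r : (r < M)%N -> (forall i, (i < r)%N -> rho i != 0) ->
  celldet k.+1 r = (if r is r'.+1 then celldet k r' else 1) * celldet k r
                   * (rho r ^+ size (paths k r.+1) * celldet k r.+1).
Proof.
move=> rM rho0; rewrite {1}/celldet /= -/(upflat k r) size_cat.
rewrite (det_gram_cat (g := downform k.+1 r) [::] erefl erefl).
- congr (_ * _); last first.
    rewrite size_map (gram_map (g := fun p q => rho r * cellform k r.+1 p q)) //;
      last first.
      by move=> p q /pathsP pw /pathsP qw; rewrite downform_down.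
    rewrite -[RHS]detZ; congr (\det _).
    by apply/matrixP => i j; rewrite !mxE.
  rewrite /upflat size_cat (det_gram_cat (g := cellform k.+1 r) [::] erefl erefl).
  + congr (_ * _); last first.
      rewrite size_map (gram_map (g := cellform k r)) // => p q _ _.
      by rewrite /cellform wformZZ.
    case: r rM {rho0} => [|r] rM; first by rewrite det_mx00.
    rewrite size_map (gram_map (g := cellform k r)) // => p q _ _.
    by rewrite /cellform wformUU eqxx mul1r.
  + move=> s z /mapP[p _ ->]; case: r rM {rho0} => [|r] rM // /mapP[q _ ->].
    rewrite /cellform wformC wformUZ (_ : (_ == _) = false) ?mul0r //.
    by apply/eqP => /(congr1 val); rewrite /= inordK //; lia.
  + by move=> s _; apply: LSpan0 => z; rewrite subrr.
- move=> s z /mapP[p /pathsP pw ->]; rewrite mem_cat => /orP[|/mapP[q _ ->]].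
    case: r rM rho0 pw => [|r] rM rho0 pw // /mapP[q /pathsP qw ->].
    exact: downform_up.
  exact/downform_flat/ltnW.
- move=> s /mapP[p /pathsP pw ->]; exact: downform_span.
Qed.

End DeterminantRecursion.

(** * Solving the recursion with Chebyshev polynomials *)

Lemma size_pathsS k r : size (paths k.+1 r) =
  ((if r is r'.+1 then size (paths k r') else 0) + size (paths k r) + size (paths k r.+1))%N.
Proof. by case: r => [|r] /=; rewrite !size_cat !size_map. Qed.

Lemma size_paths_gt k r : (k < r)%N -> size (paths k r) = 0%N.
Proof.
elim: k r => [|k IH] [|r] // kr.
by rewrite size_pathsS !IH //; lia.
Qed.

Lemma chebS (R : nzRingType) (y : R) n : cheb y n.+2 = y * cheb y n.+1 - cheb y n.
Proof. by rewrite /cheb /=; case: (cheb_aux y n). Qed.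

Lemma cheb0 (R : nzRingType) (y : R) : cheb y 0 = 1. Proof. by []. Qed.
Lemma cheb1 (R : nzRingType) (y : R) : cheb y 1 = y. Proof. by []. Qed.

(** Positivity is proved together with monotonicity in [n], which is what [2 <= y] gives. *)
Lemma cheb_gt0 (R : numDomainType) (y : R) n : 2 <= y -> 0 < cheb y n.
Proof.
move=> y2; suff [] : 0 < cheb y n /\ cheb y n <= cheb y n.+1 by [].
have y_ge : 0 <= y - 2 by rewrite subr_ge0.
elim: n => [|n [u_gt0 leu]].
  by rewrite cheb0 cheb1; split=> //; apply: le_trans y2; rewrite ler1n.
have u1 : 0 < cheb y n.+1 by apply: lt_le_trans leu.
split=> //; rewrite chebS -subr_ge0.
have -> : y * cheb y n.+1 - cheb y n - cheb y n.+1 =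
  (y - 2) * cheb y n.+1 + (cheb y n.+1 - cheb y n) by ring.
by rewrite addr_ge0 ?subr_ge0 // mulr_ge0 // ltW.
Qed.

Section ClosedFormula.
Variables (R : fieldType) (M : nat).
Notation u := (cheb (M%:R : R)).
Hypothesis u_neq0 : forall n, u n != 0.

Lemma rho_cheb r : rho R M r = u r.+1 / u r.
Proof.
elim: r => [|r IH] /=; first by rewrite cheb1 cheb0 divr1.
rewrite IH chebS; have := u_neq0 r; have := u_neq0 r.+1.
by move=> h1 h2; field; rewrite h1 h2.
Qed.

Lemma rho_neq0 r : rho R M r != 0.
Proof. by rewrite rho_cheb mulf_neq0 ?invr_eq0. Qed.

(** Any bound [L >= k] will do, because the exponents vanish past rank [k]; all terms of the
    recursion can thus share one [L]. The condition [k + r < M] survives the passage from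
    [(k + 1, r)] to [(k, r + 1)]. *)
Lemma celldet_formula k r L : (k + r < M)%N -> (k <= L)%N ->
  celldet R M k r =
  \prod_(s < L) (u (s + r).+1 / u s) ^+ size (paths k (r + s.*2).+2).
Proof.
elim: k r => [|k IH] r krM kL.
  rewrite big1 => [|s _]; last by rewrite expr0.
  case: r krM => [|r] krM; last by rewrite /celldet det_mx00.
  by rewrite /celldet /= det_mx11 mxE /cellform /wform /sumw mulr1.
rewrite celldetS; [|lia|by move=> i _; exact: rho_neq0].
rewrite (IH r) ?(IH r.+1); try lia.
(* The ratio for rank [r + 1] is [f r s * h s.+1], and the one for rank [r - 1] times [h s] is
   [f r s]. The factor [rho r] of the recursion supplies the missing [h 0], so after an index shift
   the three products match the three terms of the recursion for the number of paths. *)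
pose f r s := u (s + r).+1 / u s.
pose h s := u (s + r).+1 / u (s + r).
pose g s := size (paths k (r + s.*2).+1).
have shift : \prod_(s < L) h s ^+ g s = h 0%N ^+ g 0%N * \prod_(s < L) h s.+1 ^+ g s.+1.
  transitivity (\prod_(s < L.+1) h s ^+ g s); last by rewrite big_ord_recl.
  by rewrite big_ord_recr /= [g L]size_paths_gt ?expr0 ?mulr1 //; lia.
have -> : \prod_(s < L) (u (s + r.+1).+1 / u s) ^+ size (paths k (r.+1 + s.*2).+2) =
  \prod_(s < L) f r s ^+ g s.+1 * \prod_(s < L) h s.+1 ^+ g s.+1.
  rewrite -big_split; apply: eq_bigr => s _ /=;
    rewrite /g doubleS !addnS addSn -exprMn; congr (_ ^+ _).
  by rewrite /f /h; have := u_neq0 (s + r).+1; have := u_neq0 s => h1 h2; field;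
    rewrite h1 h2.
have -> : rho R M r ^+ size (paths k r.+1) = h 0%N ^+ g 0%N.
  by rewrite rho_cheb /h /g add0n addn0.
have -> : \prod_(s < L) (u (s + r).+1 / u s) ^+ size (paths k.+1 (r + s.*2).+2) =
  \prod_(s < L) f r s ^+ g s * \prod_(s < L) f r s ^+ size (paths k (r + s.*2).+2)
  * \prod_(s < L) f r s ^+ g s.+1.
  rewrite -!big_split; apply: eq_bigr => s _ /=.
  by rewrite -!exprD size_pathsS /g doubleS !addnS.
suff <- : (if r is r'.+1 then celldet R M k r' else 1) * \prod_(s < L) h s ^+ g s
   = \prod_(s < L) f r s ^+ g s.
  by rewrite shift /f; ring.
case: r krM @f @h @g shift => [|r] krM f h g _.
  by rewrite mul1r; apply: eq_bigr => s _; rewrite /f /h addn0.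
rewrite (IH r); try lia.
rewrite -big_split; apply: eq_bigr => s _ /=; rewrite /g addSn -exprMn; congr (_ ^+ _).
by rewrite /f /h !addnS; have := u_neq0 (s + r).+1; have := u_neq0 s => h1 h2; field;
  rewrite h1 h2.
Qed.
End ClosedFormula.

(** * Edges and white vertices of a path *)

Lemma motzw_size k r w : motzw k r w -> size w = k.
Proof. by elim=> {k r w} //= k r w _ ->. Qed.

Lemma sum_nth_rcons (p : seq int) a i n : (n <= size p)%N ->
  \sum_(i <= t < n) (rcons p a)`_t = \sum_(i <= t < n) p`_t.
Proof.
move=> np; apply: eq_big_nat => t /andP[_ tn].
by rewrite nth_rcons (leq_trans tn np).
Qed.

Lemma sum_nth_rconsS (p : seq int) a i : (i <= size p)%N ->
  \sum_(i <= t < (size p).+1) (rcons p a)`_t = \sum_(i <= t < size p) p`_t + a.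
Proof.
move=> ip; rewrite big_nat_recr //= sum_nth_rcons //.
by rewrite nth_rcons ltnn eqxx.
Qed.

Lemma path_rankE p : path_rank p = \sum_(0 <= t < size p) p`_t.
Proof. by rewrite big_mkord. Qed.

Lemma is_motzkinP p :
  reflect (forall i, (i <= size p)%N -> 0 <= \sum_(0 <= t < i) p`_t) (is_motzkin p).
Proof.
apply: (iffP forallP) => [H i ip|H i].
  by have := H (Ordinal (ip : (i < (size p).+1)%N)); rewrite big_mkord.
by have := H i; rewrite big_mkord; apply; rewrite -ltnS ltn_ord.
Qed.

Lemma path_rank_rcons p a : path_rank (rcons p a) = path_rank p + a.
Proof. by rewrite !path_rankE size_rcons sum_nth_rconsS. Qed.

Lemma is_motzkin_rcons p a :
  is_motzkin (rcons p a) = is_motzkin p && (0 <= path_rank p + a).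
Proof.
apply/is_motzkinP/andP => [H|[/is_motzkinP H r0] i].
  split; last by rewrite -path_rank_rcons path_rankE H.
  apply/is_motzkinP => i ip; rewrite -(sum_nth_rcons a) // H // size_rcons; lia.
rewrite size_rcons leq_eqVlt => /orP[/eqP->|ip].
  by rewrite sum_nth_rconsS // -path_rankE.
by rewrite sum_nth_rcons // H.
Qed.

Lemma mem_allseqsS k a w : (a :: w \in allseqs k.+1) = (a \in [:: -1; 0;
  1]) && (w \in allseqs k).
Proof.
apply/idP/andP => [/allpairsPdep[b [v [bin vin [-> ->]]]]|[ain win]] //.
by apply/allpairsPdep; exists a, w.
Qed.

Lemma mem_allseqs k w :
  (w \in allseqs k) = (size w == k) && all [in [:: -1; 0; 1 : int]] w.
Proof.
elim: k w => [|k IH] [|a w]; [by [] | by [] | rewrite [RHS]/= | rewrite [RHS]/=].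
  by apply/negP => /allpairsPdep[b [v []]].
by rewrite (mem_allseqsS k a w) IH eqSS andbCA.
Qed.

Lemma uniq_allseqs k : uniq (allseqs k).
Proof.
elim: k => //= k IH; apply: (@allpairs_uniq _ _ _ (fun a s => a :: s) [:: -1; 0; 1]) => //.
by move=> [a s] [b t] _ _ /= [-> ->].
Qed.

Lemma motz_motzw k r p : (p \in motz k r) <-> motzw k r (rev p).
Proof.
rewrite mem_filter mem_allseqs; split.
  move=> /andP[/andP[pm /eqP pr]] /andP[/eqP <- {k}].
  elim/last_ind: p r pm pr => [|p a IH] r.
    by case: r => [|r] _; rewrite /path_rank big_ord0 // => _ _; constructor.
  rewrite is_motzkin_rcons path_rank_rcons all_rcons size_rcons rev_rcons.
  move=> /andP[pm _] pr /andP[ain pin].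
  have p0 : 0 <= path_rank p.
    by move/is_motzkinP: pm => /(_ (size p) (leqnn _)); rewrite -path_rankE.
  move: ain pr; rewrite !inE => /or3P[]/eqP-> pr.
  - by constructor; apply: IH => //; lia.
  - by constructor; apply: IH => //; lia.
  - case: r pr => [|r] pr; first lia.
    by constructor; apply: IH => //; lia.
move E : (rev p) => w pw; have {p E} -> : p = rev w by rewrite -E revK.
elim: pw => {k r w} [|k r p _|k r p _|k r p _].
  rewrite /path_rank big_ord0 !andbT.
  by apply/is_motzkinP => -[|//] _; rewrite big_nil.
all: rewrite rev_cons is_motzkin_rcons path_rank_rcons size_rcons all_rcons;
  case/andP => /andP[-> /eqP->] /andP[/eqP-> ->]; rewrite eqxx !inE /= ?andbT; lia.
Qed.

Lemma uniq_paths k r : uniq (paths k r).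
Proof.
have inj (a : int) : injective (cons a) by move=> s t [].
elim: k r => [|k IH] [|r] //=; rewrite !cat_uniq !map_inj_uniq // !IH //= ?andbT.
  by apply/hasPn => w /mapP[p _ ->]; apply/negP => /mapP[].
apply/andP; split; apply/hasPn => w /mapP[p _ ->].
  by apply/negP => /mapP[].
by rewrite mem_cat negb_or; apply/andP; split; apply/negP => /mapP[].
Qed.

Lemma perm_motz_paths k r : perm_eq [seq rev p | p <- motz k r] (paths k r).
Proof.
apply: uniq_perm; [|exact: uniq_paths|].
  by rewrite map_inj_uniq; [exact/filter_uniq/uniq_allseqs | exact: (can_inj revK)].
move=> w; rewrite -[w]revK (mem_map (can_inj revK)).
by apply/idP/pathsP => [/motz_motzw|] //; rewrite revK // => h; apply/motz_motzw;
  rewrite revK.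
Qed.

Lemma size_paths k r : size (paths k r) = mkr k r.
Proof. by rewrite -(perm_size (perm_motz_paths k r)) size_map. Qed.

(* White positions of the reversed word [w], the rightmost one first. *)
Fixpoint whites (w : seq int) : seq nat :=
  if w is a :: w' then
    if a == 1 then size w' :: whites w'
    else if a == 0 then whites w' else behead (whites w')
  else [::].

Fixpoint arcs (w : seq int) : seq (nat * nat) :=
  if w is a :: w' then
    if a == -1 then
      if whites w' is h :: _ then (h, size w') :: arcs w' else arcs w'
    else arcs w'
  else [::].

Lemma size_whites k r w : motzw k r w -> size (whites w) = r.
Proof. by elim=> {k r w} //= k r w _; [move-> | rewrite size_behead => ->]. Qed.

Lemma whites_lt k r w : motzw k r w -> all (fun i => i < k)%N (whites w).
Proof.
elim=> {k r w} //= k r w pw IH.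
- rewrite (motzw_size pw) leqnn /=; apply: sub_all IH => i; exact: leqW.
- apply: sub_all IH => i; exact: leqW.
- case: (whites w) IH => //= h l /andP[_]; apply: sub_all => i; exact: leqW.
Qed.

Lemma whites_uniq k r w : motzw k r w -> uniq (whites w).
Proof.
elim=> {k r w} //= k r w pw IH; last by case: (whites w) IH => //= h l /andP[].
rewrite IH (motzw_size pw) andbT; apply/negP => /(allP (whites_lt pw)).
by rewrite ltnn.
Qed.

(** An up step not yet closed within [p]. Unlike [white] it speaks of partial sums only, so it can
    be followed while steps are appended. *)
Definition open_at (p : seq int) (i : nat) : Prop :=
  [/\ (i < size p)%N, p`_i = 1 &
      forall t, (i <= t < size p)%N -> \sum_(i <= s < t.+1) p`_s != 0].

Lemma open_at_rcons p a i : (i < size p)%N ->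
  open_at (rcons p a) i <-> open_at p i /\ \sum_(i <= s < size p) p`_s + a != 0.
Proof.
move=> ip; rewrite /open_at size_rcons nth_rcons ip; split=> [[_ p1 H]|[[_ p1 H] H']].
  split; first (split=> // t /andP[it tp]).
    by have := H t; rewrite sum_nth_rcons //; apply; lia.
  by have := H (size p); rewrite sum_nth_rconsS 1?ltnW //; apply; lia.
split=> // [|t /andP[it]]; first lia.
rewrite ltnS leq_eqVlt => /orP[/eqP->|tp]; first by rewrite sum_nth_rconsS // ltnW.
by rewrite sum_nth_rcons //; apply: H; lia.
Qed.

Lemma open_at_last p a : open_at (rcons p a) (size p) <-> a = 1.
Proof.
rewrite /open_at size_rcons nth_rcons ltnn eqxx; split=> [[]|-> ] //.
split=> // t tp; have -> : t = size p by lia.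
by rewrite sum_nth_rconsS // big_geq // add0r.
Qed.

(** The second clause makes the induction work: the sum from a white vertex to the end is one more
    than its index in the list. Hence a further down step closes exactly the head of the list. *)
Lemma whitesP k r w : motzw k r w -> forall i, (i < k)%N ->
  (i \in whites w <-> open_at (rev w) i) /\
  (i \in whites w -> \sum_(i <= s < k) (rev w)`_s = (index i (whites w)).+1%:Z).
Proof.
elim=> {k r w} [//|k r w pw IH|k r w pw IH|k r w pw IH] i ik1;
  have sw : size (rev w) = k by rewrite size_rev (motzw_size pw).
all: have ltk := allP (whites_lt pw); rewrite rev_cons.
all: have O a : (i < k)%N -> open_at (rcons (rev w) a) i <->
       open_at (rev w) i /\ \sum_(i <= s < k) (rev w)`_s + a != 0
       by move=> lt_ik; have := @open_at_rcons (rev w) a i; rewrite sw => /(_ lt_ik).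
all: have Ok a : i = k -> open_at (rcons (rev w) a) i <-> a = 1
       by move=> ->; have := open_at_last (rev w) a; rewrite sw.
all: have [ik|ki|ik] := ltngtP i k; [|lia|].
all: try have [IH1 IH2] := IH i ik.
all: have ik' : (i <= size (rev w))%N by lia.
all: have S a := sum_nth_rconsS a ik'; rewrite {ik'}sw in S.
all: rewrite {}S.
- have ikn : (k == i) = false by apply/eqP; lia.
  rewrite /= (motzw_size pw) inE eq_sym ikn /=.
  split; last by move/IH2->; lia.
  apply: (iff_trans _ (iff_sym (O _ ik))); split=> [iw|[/IH1]//].
  by split; [apply/IH1 | rewrite IH2 //; lia].
- subst i; rewrite /= (motzw_size pw) inE eqxx /=; split=> [|_].
    by split=> // _; apply/(Ok _ erefl).
  by rewrite big_geq // add0r.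
- rewrite /= addr0; split; last by move/IH2->.
  apply: (iff_trans _ (iff_sym (O _ ik))); rewrite addr0; split=> [iw|[/IH1]//].
  by split; [apply/IH1 | rewrite IH2].
- subst i; have bk : (k \in whites w) = false by apply/negP => /ltk; rewrite ltnn.
  by rewrite /= bk; split=> //; split=> // /(Ok _ erefl).
- have := size_whites pw; have := whites_uniq pw; rewrite /=.
  case: (whites w) IH1 IH2 {ltk} => // h l IH1 IH2 /= /andP[hl _] _.
  case: (eqVneq h i) => [hi|hi].
    subst h; split; last by rewrite (negPf hl).
    apply: (iff_trans _ (iff_sym (O _ ik))).
    by rewrite (negPf hl); split=> // -[_]; rewrite IH2 ?mem_head //= eqxx subrr.
  have IH2' := IH2; rewrite /= inE eq_sym (negPf hi) /= in IH1 IH2'.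
  split=> [|il]; last by rewrite IH2' //; lia.
  apply: (iff_trans _ (iff_sym (O _ ik))).
  split=> [il|[/IH1]//]; split; first exact/IH1.
  by rewrite IH2' //; lia.
- subst i; have bk : (k \in whites (-1 :: w)) = false.
    apply/negP => /= /mem_behead /ltk; by rewrite ltnn.
  by rewrite bk; split=> //; split=> // /(Ok _ erefl).
Qed.

Lemma paired_rcons p a i j : (j < size p)%N -> paired (rcons p a) i j = paired p i j.
Proof.
move=> jp; rewrite /paired /psum; case: (ltnP i j) => ij; last by rewrite !andbF.
rewrite nth_rcons (ltn_trans ij jp) sum_nth_rcons //; congr [&& _, _, _ & _].
apply: eq_in_all => t; rewrite mem_iota (subnKC (ltnW ij)) => /andP[it tj].
by rewrite sum_nth_rcons //; lia.
Qed.

Lemma paired_last p a i : (i < size p)%N ->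
  paired (rcons p a) i (size p) <->
  open_at p i /\ \sum_(i <= s < size p) p`_s + a = 0.
Proof.
move=> ip; rewrite /paired /psum ip nth_rcons ip sum_nth_rconsS 1?ltnW //.
split.
  move=> /and4P[/eqP p1 _ /eqP s0 /allP H]; split=> //; split=> // t tp.
  rewrite -(sum_nth_rcons a) ?H ?mem_iota ?(subnKC (ltnW ip)) //; lia.
move=> [[_ p1 H] ->]; rewrite p1 !eqxx /=; apply/allP => t.
rewrite mem_iota (subnKC (ltnW ip)) => tp.
by rewrite sum_nth_rcons ?H //; lia.
Qed.

Lemma mem_arcs_lt k r w : motzw k r w -> forall i j, (i, j) \in arcs w -> (i < j < k)%N.
Proof.
elim=> {k r w} //= k r w pw IH i j.
- by move/IH; lia.
- by move/IH; lia.
have := whites_lt pw; case: (whites w) => [|h l] /=; first by move=> _ /IH; lia.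
by move=> /andP[hk _]; rewrite inE (motzw_size pw) => /orP[/eqP[-> ->]|/IH]; lia.
Qed.

(** Only pairs ending at the last step are new. By [whitesP] the remaining sum of an open [i] is its
    index plus one, which the last step cancels only if it is a down step and [i] is the head. *)
Lemma pairedP k r w : motzw k r w -> forall i j, (j < k)%N ->
  paired (rev w) i j = ((i, j) \in arcs w).
Proof.
elim=> {k r w} [//|k r w pw IH|k r w pw IH|k r w pw IH] i j jk1;
  have sw : size (rev w) = k by rewrite size_rev (motzw_size pw).
all: rewrite rev_cons; have [jk|kj|jk] := ltngtP j k; [|lia|subst j].
all: try by rewrite paired_rcons ?sw // IH.
3: { rewrite paired_rcons ?sw // IH //=; case: (whites w) => // h l;
  rewrite inE (motzw_size pw).
  by rewrite (_ : (_ == _) = false) //; apply/eqP => -[_ jk']; lia. }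
all: have out : ((i, k) \in arcs w) = false by apply/negP => /(mem_arcs_lt pw); lia.
all: case: (ltnP i k) => ik; last first.
all: try by rewrite /paired ltnNge ik !andbF /= ?out.
3: by rewrite /paired ltnNge ik !andbF;
  apply/esym/negP => /(mem_arcs_lt (MotzDown pw)); lia.
all: have [W1 W2] := whitesP pw ik.
all: have P a : paired (rcons (rev w) a) i k <->
  i \in whites w /\ (index i (whites w)).+1%:Z + a = 0.
all: try by move: (@paired_last (rev w) a i); rewrite sw => /(_ ik) [F1 F2];
  split=> [/F1[/W1 iw]|[iw e]]; [rewrite W2 | apply: F2; split; [apply/W1 | rewrite W2]].
- by rewrite /= out; apply/negP => /P[_]; lia.
- by rewrite /= out; apply/negP => /P[_]; lia.
have := size_whites pw; rewrite /=; case: (whites w) P {W1 W2} => // h l P _.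
rewrite inE out orbF (motzw_size pw) xpair_eqE eqxx andbT.
apply/idP/eqP => [/P[_]|ih]; last by apply/P; rewrite ih mem_head /= eqxx subrr.
by rewrite /= eq_sym; case: eqP => //; lia.
Qed.

Lemma nth_rev_consl (w : seq int) a i : (i < size w)%N -> (rev (a :: w))`_i = (rev w)`_i.
Proof. by move=> iw; rewrite rev_cons nth_rcons size_rev iw. Qed.

Lemma nth_rev_cons_last (w : seq int) a : (rev (a :: w))`_(size w) = a.
Proof. by rewrite rev_cons nth_rcons size_rev ltnn eqxx. Qed.

Lemma arcs_not_white k r w : motzw k r w -> forall i j, (i, j) \in arcs w ->
  i \notin whites w /\ j \notin whites w.
Proof.
elim=> {k r w} [//|k r w pw IH|k r w pw IH|k r w pw IH] i j ij.
- rewrite /= in ij; have := mem_arcs_lt pw ij; have [wi wj] := IH _ _ ij.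
  rewrite /= !inE (motzw_size pw) (negPf wi) (negPf wj) => lt.
  by split; apply/norP; split=> //; lia.
- exact: IH.
move: ij; have := whites_uniq pw; have := allP (whites_lt pw); rewrite /= (motzw_size pw).
case: (whites w) IH => [|h l] IH ltk /=; first by move=> _ /IH[].
case/andP=> hl _; rewrite inE => /orP[/eqP[-> ->]|].
  split=> //; apply/negP => kl; have := ltk k; rewrite inE kl orbT ltnn.
  by move/(_ isT).
by move/IH; rewrite !inE !negb_or => -[/andP[_ ->] /andP[_ ->]].
Qed.

Lemma arcs_letters k r w : motzw k r w -> forall i j, (i, j) \in arcs w ->
  (rev w)`_i = 1 /\ (rev w)`_j = -1.
Proof.
elim=> {k r w} [//|k r w pw IH|k r w pw IH|k r w pw IH] i j ij.
- by have := mem_arcs_lt pw ij => lt; rewrite !nth_rev_consl ?(motzw_size pw); try lia;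
  apply: IH.
- by have := mem_arcs_lt pw ij => lt; rewrite !nth_rev_consl ?(motzw_size pw); try lia;
  apply: IH.
move: ij; rewrite [arcs _]/=; case W : (whites w) => [|h l].
  by move=> ij; have := mem_arcs_lt pw ij => lt;
    rewrite !nth_rev_consl ?(motzw_size pw); try lia; apply: IH.
rewrite inE => /orP[/eqP[-> ->]|ij]; last first.
  by have := mem_arcs_lt pw ij => lt; rewrite !nth_rev_consl ?(motzw_size pw); try lia;
    apply: IH.
have hw : h \in whites w by rewrite W mem_head.
have hk : (h < k)%N := allP (whites_lt pw) _ hw.
rewrite nth_rev_cons_last nth_rev_consl ?(motzw_size pw) //.
by have [/(_ hw)[_ ->]] := (whitesP pw hk).1.
Qed.

Lemma arcs_injr k r w : motzw k r w -> forall i i' j,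
  (i, j) \in arcs w -> (i', j) \in arcs w -> i = i'.
Proof.
elim=> {k r w} //= k r w pw IH i i' j.
have lt := mem_arcs_lt pw; case: (whites w) => [|h l]; first exact: IH.
rewrite !inE (motzw_size pw).
move=> /orP[/eqP[e1 e2]|ij] /orP[/eqP[e3 e4]|i'j].
- by rewrite e1 e3.
- by have := lt _ _ i'j; lia.
- by have := lt _ _ ij; lia.
- exact: IH i'j.
Qed.

Lemma arcs_injl k r w : motzw k r w -> forall i j j',
  (i, j) \in arcs w -> (i, j') \in arcs w -> j = j'.
Proof.
elim=> {k r w} //= k r w pw IH i j j'.
have nw := arcs_not_white pw; case: (whites w) nw => [|h l] nw; first exact: IH.
rewrite !inE (motzw_size pw).
move=> /orP[/eqP[ih e1]|ij] /orP[/eqP[ih' e2]|ij'].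
- by rewrite e1 e2.
- by have [] := nw _ _ ij'; rewrite ih mem_head.
- by have [] := nw _ _ ij; rewrite ih' mem_head.
- exact: IH ij'.
Qed.

Lemma arcs_cover k r w : motzw k r w -> forall i, (i < k)%N ->
  [\/ (rev w)`_i = 0, i \in whites w | exists j, (i, j) \in arcs w \/ (j, i) \in arcs w].
Proof.
elim=> {k r w} [//|k r w pw IH|k r w pw IH|k r w pw IH] i ik1.
all: have sw := motzw_size pw; have [ik|ki|ik] := ltngtP i k; [|lia|subst i].
- rewrite nth_rev_consl ?sw //; case: (IH i ik) => [?|iw|?]; first by constructor 1.
    by constructor 2; rewrite /= inE iw orbT.
  by constructor 3.
- by constructor 2; rewrite /= sw mem_head.
- by rewrite nth_rev_consl ?sw //; case: (IH i ik) => ?;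
  [constructor 1|constructor 2|constructor 3].
- by constructor 1; rewrite -{1}sw nth_rev_cons_last.
- rewrite nth_rev_consl ?sw //; case: (IH i ik) => [?|iw|[j ij]]; first by constructor 1.
    rewrite /=; case: (whites w) iw => // h l; rewrite inE => /orP[/eqP->|il].
      by constructor 3; exists k; left; rewrite sw mem_head.
    by constructor 2.
  constructor 3; exists j; rewrite /=; case: (whites w) => // h l.
  by rewrite !inE; case: ij => ->; [left|right]; rewrite orbT.
- constructor 3; have := size_whites pw; rewrite /=; case: (whites w) => // h l _.
  by exists h; right; rewrite sw mem_head.
Qed.

(** * The stack scan as a system of constraints on colourings *)

Section ColouringSemantics.
Variable M : nat.
Notation C := 'I_M.+1.
Implicit Types (c s : seq C).

Definition colour_at c i : C := nth ord0 c (size c - i.+1).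

Lemma colour_at_cons e c i : (i < size c)%N -> colour_at (e :: c) i = colour_at c i.
Proof.
by move=> ic; rewrite /colour_at /= (_ : ((size c).+1 - i.+1)%N = (size c - i.+1).+1) //; lia.
Qed.

Lemma colour_at_last e c : colour_at (e :: c) (size c) = e.
Proof. by rewrite /colour_at /= subnn. Qed.

(** A colour pushed by a down step is popped by the up step joined to it, while the stack supplied
    from outside is consumed by the white vertices. *)
Lemma compat_map k r w : motzw k r w -> forall c s, size c = k ->
  compat w c s <->
  [/\ forall i, (i < k)%N -> (rev w)`_i = 0 -> colour_at c i = ord0,
      forall i j, (i, j) \in arcs w -> colour_at c i = colour_at c j &
      map (colour_at c) (whites w) = s].
Proof.
elim=> {k r w} [|k r w pw IH|k r w pw IH|k r w pw IH] [|e c] s //.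
- by move=> _; split=> [/= /eqP->|[_ _ /= <-]].
all: case=> sc; have sw := motzw_size pw; have lt := mem_arcs_lt pw;
  have ltw := allP (whites_lt pw);
  have mapE : map (colour_at (e :: c)) (whites w) = map (colour_at c) (whites w)
    by apply/eq_in_map => i /ltw ik; rewrite colour_at_cons ?sc.
- split.
    case: s => // h s /= /andP[/eqP-> /IH[//|H0 Ha Hw]]; split.
    + move=> i; rewrite ltnS leq_eqVlt => /orP[/eqP->|ik].
        by rewrite -sw nth_rev_cons_last.
      by rewrite nth_rev_consl ?sw // colour_at_cons ?sc //; apply: H0.
    + by move=> i j ij; have := lt _ _ ij => ltij; rewrite !colour_at_cons ?sc;
      try lia; exact: Ha.
    + by rewrite mapE Hw sw -sc colour_at_last.
  move=> [H0 Ha /= <-]; rewrite sw -{1}sc colour_at_last eqxx mapE /=; apply/IH => //;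
    split=> //.
  + move=> i ik; have := H0 i (leqW ik); rewrite nth_rev_consl ?sw // colour_at_cons ?sc //.
  + by move=> i j ij; have := lt _ _ ij => ltij; have := Ha _ _ ij;
    rewrite !colour_at_cons ?sc //; lia.
- split.
    move=> /= /andP[/eqP e0 /IH[//|H0 Ha Hw]]; split.
    + move=> i; rewrite ltnS leq_eqVlt => /orP[/eqP->|ik].
        by rewrite -{2}sc colour_at_last.
      by rewrite nth_rev_consl ?sw // colour_at_cons ?sc //; apply: H0.
    + by move=> i j ij; have := lt _ _ ij => ltij; rewrite !colour_at_cons ?sc;
      try lia; exact: Ha.
    + by rewrite mapE Hw.
  move=> [H0 Ha /= <-]; have := H0 k (leqnn _);
    rewrite -{1}sw nth_rev_cons_last -sc colour_at_last.
  move=> e0; rewrite mapE e0 // eqxx /=; apply/IH => //; split=> //.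
  + move=> i ik; have := H0 i (leqW ik); rewrite nth_rev_consl ?sw // colour_at_cons ?sc //.
  + by move=> i j ij; have := lt _ _ ij => ltij; have := Ha _ _ ij;
    rewrite !colour_at_cons ?sc //; lia.
- have := size_whites pw; rewrite /=.
  case W : (whites w) mapE ltw => [//|h l] mapE ltw _.
  have hk : (h < k)%N by apply: ltw; rewrite mem_head.
  case: mapE => mh ml.
  split.
    move=> /IH[//|H0 Ha Hw]; rewrite W in Hw; case: Hw => ch cl; split.
    + move=> i; rewrite ltnS leq_eqVlt => /orP[/eqP->|ik].
        by rewrite -{1}sw nth_rev_cons_last.
      by rewrite nth_rev_consl ?sw // colour_at_cons ?sc //; apply: H0.
    + move=> i j; rewrite inE => /orP[/eqP[-> ->]|ij].
        by rewrite sw -sc colour_at_last colour_at_cons ?sc.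
      by have := lt _ _ ij => ltij; rewrite !colour_at_cons ?sc; try lia; exact: Ha.
    + by rewrite ml cl.
  move=> [H0 Ha /= <-]; apply/IH => //; split=> //.
  + move=> i ik; have := H0 i (leqW ik); rewrite nth_rev_consl ?sw // colour_at_cons ?sc //.
  + move=> i j ij; have := lt _ _ ij => ltij; have := Ha i j.
    by rewrite inE ij orbT !colour_at_cons ?sc; try lia; apply.
  + rewrite W /= ml; congr (_ :: _).
    by have := Ha h k;
      rewrite inE sw eqxx /= -{1}sc colour_at_last colour_at_cons ?sc //; apply.
Qed.

Lemma compatP k r w c s : motzw k r w -> size c = k -> size s = r ->
  compat w c s <->
  [/\ forall i, (i < k)%N -> (rev w)`_i = 0 -> colour_at c i = ord0,
      forall i j, (i, j) \in arcs w -> colour_at c i = colour_at c j &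
      forall i, i \in whites w -> colour_at c i = nth ord0 s (index i (whites w))].
Proof.
move=> pw sc ss; split.
  move=> /(compat_map pw s sc)[H0 Ha <-]; split=> // i iw.
  by rewrite (nth_map 0%N) ?index_mem // nth_index.
move=> [H0 Ha Hw]; apply/(compat_map pw s sc); split=> //.
apply: (@eq_from_nth _ ord0); first by rewrite size_map (size_whites pw) ss.
rewrite size_map => n nl; rewrite (nth_map 0%N) // Hw ?mem_nth //.
by rewrite index_uniq // (whites_uniq pw).
Qed.

End ColouringSemantics.

(** * Gluing two diagrams *)

(** With the edges of two diagrams as involutions on the middle row, cycles are closed loops, and
    the open components end at fixed points. *)
Definition dihedral (T : eqType) (s t : T -> T) : rel T :=
  fun x y => (s x == y) || (t x == y).

Section Dihedral.
Local Open Scope nat_scope.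
Variables (T : finType) (s t : T -> T).
Hypotheses (sK : involutive s) (tK : involutive t).
Notation conn := (connect (dihedral s t)).

Let f x := t (s x).
Let g x := s (t x).

Lemma dihedral_sym : connect_sym (dihedral s t).
Proof.
apply: sym_connect_sym => x y; apply/idP/idP => /orP[]/eqP <-;
  by rewrite /dihedral ?sK ?tK eqxx ?orbT.
Qed.

Let f_inj : injective f. Proof. exact: inj_comp (inv_inj tK) (inv_inj sK). Qed.

Let f_iter_inj n : injective (iter n f).
Proof. by elim: n => [|n IH] x y //= /f_inj /IH. Qed.

Let iter_fg n x : iter n f (iter n g x) = x.
Proof.
elim: n => [//|n IH]; rewrite iterSr /=.
by rewrite -[RHS]IH; congr (iter n f _); rewrite /f /g sK tK.
Qed.

Let tf x : t (f x) = s x. Proof. by rewrite /f tK. Qed.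

Let s_iter n x : s x = x -> s (iter n f x) = iter n g x.
Proof. by move=> sx; elim: n => //= n <-. Qed.

Let iter_eq n x : iter n f x = x -> order f x %| n.
Proof.
move=> nx; have o0 := order_gt0 f x.
suff : n %% order f x = 0%N by move/eqP.
have mx : iter (n %% order f x) f x = x.
  rewrite -[RHS]nx [in RHS](divn_eq n (order f x)) addnC iterD; congr iter.
  elim: (n %/ _)%N => [//|a IH]; by rewrite mulSn addnC iterD iter_order.
have := findex_iter (ltn_pmod n o0); rewrite mx findex0 //.
Qed.

Let conn_iter x y : s x = x -> conn x y -> exists n, y = iter n f x.
Proof.
move=> sx /connectP[p]; elim/last_ind: p y => [|p z IH] y; first by move=> _ ->; exists 0%N.
rewrite rcons_path last_rcons => /andP[px pz] ->.
have [n en] := IH _ px erefl.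
have [n' en'] : exists n', s (iter n f x) = iter n' f x.
  (* [s] sends [f^n x] to [f^(-n) x]; the order of [x] under [f] turns this into a nonnegative
     exponent. *)
  rewrite s_iter //; exists (n * (order f x).-1)%N.
  apply: (@f_iter_inj n) => /=; rewrite iter_fg -iterD.
  have -> : (n + n * (order f x).-1 = n * order f x)%N by have := order_gt0 f x; nia.
  elim: (n) => [//|a IHa]; by rewrite mulSn addnC iterD iter_order // IHa.
move: pz; rewrite en => /orP[]/eqP<-; first by exists n'.
by exists n'.+1; rewrite iterS -en' /f sK.
Qed.

Lemma conn_s x : conn x (s x). Proof. by apply: connect1; rewrite /dihedral eqxx. Qed.
Lemma conn_t x : conn x (t x). Proof. by apply: connect1; rewrite /dihedral eqxx orbT. Qed.

Let conn_iterf n x : conn x (iter n f x).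
Proof.
elim: n => [|n IH]; first exact: connect0.
by rewrite iterS; apply: connect_trans IH _; apply: connect_trans (conn_s _) (conn_t _).
Qed.

(* A component containing a fixed point of [s] is the orbit of that point under
   [t \o s], on which [s] and [t] act as reflections: the parity of its length
   decides the kind of the other end. *)
Lemma dihedral_ends_uniq x y z : s x = x -> s y = y -> t z = z ->
  conn x y -> conn x z -> x = y.
Proof.
move=> sx sy tz /(conn_iter sx)[n yn] /(conn_iter sx)[a za].
have m2n : order f x %| n * 2.
  apply: iter_eq; rewrite muln2 -addnn iterD -yn -{1}sy yn s_iter //.
(* A point [f^a x] fixed by [t] makes the order divide [2a - 1]. Adding a full period keeps the
   point and makes the exponent positive, so the subtraction does not truncate. *)
have m2a : order f x %| (a + order f x) * 2 - 1.
  have zb : z = iter (a + order f x) f x by rewrite iterD iter_order.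
  have := order_gt0 f x; case e : (a + order f x)%N zb => [|b] zb o0; first lia.
  apply: iter_eq; rewrite (_ : (b.+1 * 2 - 1 = b + b.+1)%N); last lia.
  by rewrite iterD -zb -tz zb iterS tf s_iter.
have : order f x %| n.
  have odd_m : coprime (order f x) 2.
    rewrite coprimen2; case om: (odd _) => //; exfalso.
    have : 2 %| (a + order f x) * 2 - 1 by apply: dvdn_trans m2a; rewrite dvdn2 om.
    by have := order_gt0 f x; lia.
  by rewrite -(Gauss_dvdl n odd_m).
move/dvdnP=> [b nb]; rewrite yn nb.
by elim: b {nb} => [//|b IHb]; rewrite mulSn addnC iterD iter_order.
Qed.

(** The other end lies half way round the orbit: at [f^(h+1) x] for order [2h + 1], and at [f^h x]
    for order [2h]. *)
Lemma dihedral_other_end x : s x = x ->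
  (exists2 z, t z = z & conn x z) \/ (exists2 y, s y = y & y != x /\ conn x y).
Proof.
move=> sx; have o0 := order_gt0 f x; have := odd_double_half (order f x).
case: (odd _) => /= om.
  left; exists (iter (order f x)./2.+1 f x) => //.
  rewrite {1}iterS tf s_iter //; apply: (@f_iter_inj (order f x)./2).
  rewrite iter_fg -iterD -{1}(iter_order f_inj x); congr iter; lia.
right; exists (iter (order f x)./2 f x); last split=> //.
  rewrite s_iter //; apply: (@f_iter_inj (order f x)./2).
  rewrite iter_fg -iterD -{1}(iter_order f_inj x); congr iter; lia.
apply/eqP => /iter_eq /dvdn_leq; lia.
Qed.
End Dihedral.

(** * Counting colourings constant on components *)

Section CountColourings.
Variables (T C : finType) (x0 : C) (s t : T -> T).
Hypotheses (sK : involutive s) (tK : involutive t).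
Notation conn := (connect (dihedral s t)).

Definition loopy x := [forall y, conn x y ==> ((s y != y) && (t y != y))].

Definition loop_roots := [set x | loopy x & fingraph.root (dihedral s t) x == x].

Definition respects (hs ht g : T -> C) :=
  [forall x, [&& g (s x) == g x, g (t x) == g x, (s x == x) ==> (g x == hs x)
                 & (t x == x) ==> (g x == ht x)]].

Lemma respectsP hs ht g : reflect
  (forall x, [/\ g (s x) = g x, g (t x) = g x, s x = x -> g x = hs x & t x = x ->
    g x = ht x])
  (respects hs ht g).
Proof.
apply: (iffP forallP) => H x.
  have /and4P[/eqP-> /eqP-> /implyP h1 /implyP h2] := H x.
  by split=> // e; apply/eqP; [apply: h1 | apply: h2]; apply/eqP.
have [-> -> h1 h2] := H x; rewrite !eqxx /=.
by apply/andP; split; apply/implyP => /eqP e; apply/eqP; [apply: h1 | apply: h2].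
Qed.

Lemma dihedral_const (g : T -> C) : (forall x, g (s x) = g x) ->
  (forall x, g (t x) = g x) ->
  forall x y, conn x y -> g x = g y.
Proof.
move=> gs gt x y /connectP[p]; elim: p x => [|z p IH] x /=; first by move=> _ ->.
by case/andP=> /orP[]/eqP<- zp /(IH _ zp)<-.
Qed.

Let csym := dihedral_sym sK tK.

Lemma loopy_conn x y : conn x y -> loopy x = loopy y.
Proof.
move=> xy; apply: eq_forallb => z; congr (_ ==> _).
exact: (same_connect csym).
Qed.

(** A component with a fixed point has its colour forced, hence equal to that of [c0]; any other
    component has one free colour, recorded at its root. [x0] is the dummy value off the roots. *)
Lemma card_respects hs ht (c0 : T -> C) : respects hs ht c0 ->
  #|[set g : {ffun T -> C} | respects hs ht g]| = (#|C| ^ #|loop_roots|)%N.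
Proof.
move=> /respectsP R0.
have c0c : forall x y, conn x y -> c0 x = c0 y.
  by apply: dihedral_const => x; have [] := R0 x.
pose res (g : {ffun T -> C}) := [ffun x => if x \in loop_roots then g x else x0].
have fixed (g : T -> C) x : respects hs ht g -> ~~ loopy x -> g x = c0 x.
  move=> /respectsP Rg; rewrite negb_forall => /existsP[y].
  rewrite negb_imply negb_and !negbK => /andP[xy fy].
  have gc : g x = g y by apply: dihedral_const xy => z; have [] := Rg z.
  rewrite gc (c0c _ _ xy); have [_ _ h1 h2] := Rg y; have [_ _ k1 k2] := R0 y.
  by case/orP: fy => /eqP e; [rewrite h1 // k1 | rewrite h2 // k2].
have rootE (g : T -> C) x : respects hs ht g -> g x = g (fingraph.root (dihedral s t) x).
  move=> /respectsP Rg; apply: dihedral_const (connect_root _ x) => z; by have [] := Rg z.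
have lr x : loopy x -> fingraph.root (dihedral s t) x \in loop_roots.
  by move=> lx; rewrite inE -(loopy_conn (connect_root _ x)) lx (root_root csym x) eqxx.
rewrite -cardsT -[RHS](card_pffun_on x0) -(@card_in_imset _ _ res); last first.
  move=> g h; rewrite !inE => Rg Rh /ffunP gh; apply/ffunP => x.
  case lx: (loopy x); last by rewrite !fixed ?lx.
  rewrite (rootE g) // (rootE h) //.
  by have := gh (fingraph.root (dihedral s t) x); rewrite !ffunE lr.
apply: eq_card => h; apply/imsetP/pffun_onP => [[g _ ->]|[hsupp _]].
  split=> [|y]; last by rewrite inE.
  by apply/supportP => x xl; rewrite ffunE (negPf xl).
exists [ffun x => if loopy x then h (fingraph.root (dihedral s t) x) else c0 x].
  rewrite inE; apply/respectsP => x; rewrite !ffunE.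
  rewrite -(loopy_conn (conn_s s t x)) -(loopy_conn (conn_t s t x)).
  have [c0s c0t f1 f2] := R0 x.
  have rs : fingraph.root (dihedral s t) (s x) = fingraph.root (dihedral s t) x.
    by apply/esym/eqP; rewrite (root_connect csym) conn_s.
  have rt : fingraph.root (dihedral s t) (t x) = fingraph.root (dihedral s t) x.
    by apply/esym/eqP; rewrite (root_connect csym) conn_t.
  rewrite rs rt c0s c0t; case lx: (loopy x); split=> // e.
    by have /forallP/(_ x) := lx; rewrite connect0 e eqxx.
  by have /forallP/(_ x) := lx; rewrite connect0 e eqxx andbF.
apply/ffunP => x; rewrite !ffunE; case: ifP => xl.
  by move: (xl); rewrite inE => /andP[-> /eqP->].
by have /supportP-> := hsupp; rewrite ?xl.
Qed.

End CountColourings.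

(** * The edges of a path as an involution *)

Section Mates.
Variable k : nat.
Implicit Types (i j : 'I_k) (w : seq int).

Definition joined w i j := ((val i, val j) \in arcs w) || ((val j, val i) \in arcs w).

(** A vertex on no edge is its own mate, so the fixed points are the white vertices and the flat
    steps. *)
Definition mate w i := odflt i [pick j | joined w i j].

Definition is_white w i := val i \in whites w.

Lemma joined_sym w i j : joined w i j = joined w j i.
Proof. by rewrite /joined orbC. Qed.

Variables (r : nat) (w : seq int).
Hypothesis pw : motzw k r w.

Lemma joined_uniq i j j' : joined w i j -> joined w i j' -> j = j'.
Proof.
move=> h h'; apply: val_inj; move: h h'; rewrite /joined => /orP[]ij /orP[]ij'.
- exact: (arcs_injl pw) ij ij'.
- have [h1 _] := arcs_letters pw ij; have [_ h2] := arcs_letters pw ij'.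
  by rewrite h1 in h2.
- have [_ h1] := arcs_letters pw ij; have [h2 _] := arcs_letters pw ij'.
  by rewrite h1 in h2.
- exact: (arcs_injr pw) ij ij'.
Qed.

Lemma joinedxx i : joined w i i = false.
Proof. by apply/negP => /orP[] /(mem_arcs_lt pw); lia. Qed.

Lemma mate_joined i j : joined w i j -> mate w i = j.
Proof.
rewrite /mate => ij; case: pickP => [j' ij'|/(_ j)]; last by rewrite ij.
exact: joined_uniq ij' ij.
Qed.

Lemma mateP i : (mate w i == i) = ~~ [exists j, joined w i j].
Proof.
rewrite /mate; case: pickP => [j ij|none] /=.
  have -> : [exists j, joined w i j] by apply/existsP; exists j.
  by apply/eqP => ji; rewrite ji joinedxx in ij.
by rewrite eqxx; apply/esym/existsPn => j; rewrite none.
Qed.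

Lemma joined_mate i : mate w i != i -> joined w i (mate w i).
Proof.
by rewrite mateP negbK => /existsP[j ij]; rewrite (mate_joined ij).
Qed.

Lemma mateK : involutive (mate w).
Proof.
move=> i; have [e|ne] := eqVneq (mate w i) i; first by rewrite !e.
by apply: mate_joined; rewrite joined_sym joined_mate.
Qed.

Lemma white_not_joined i j : is_white w i -> joined w i j = false.
Proof.
move=> iw; apply/negP => /orP[] /(arcs_not_white pw)[/negP h1 /negP h2].
  exact: h1.
exact: h2.
Qed.

Lemma white_mate i : is_white w i -> mate w i = i.
Proof.
by move=> iw; apply/eqP; rewrite mateP; apply/existsPn => j; rewrite white_not_joined.
Qed.

Lemma flat_mate i : (rev w)`_i = 0 -> mate w i = i.
Proof.
move=> i0; apply/eqP; rewrite mateP; apply/existsPn => j.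
by apply/negP => /orP[] /(arcs_letters pw)[]; rewrite i0.
Qed.

Lemma mate_fixed i : mate w i = i -> is_white w i \/ (rev w)`_i = 0.
Proof.
move=> /eqP; rewrite mateP => /existsPn H.
case: (arcs_cover pw (ltn_ord i)) => [|iw|[j ij]]; [by right | by left |].
have jk : (j < k)%N by case: ij => /(mem_arcs_lt pw); lia.
by have := H (Ordinal jk); rewrite /joined /=; case: ij => ->; rewrite ?orbT.
Qed.

Lemma flat_not_white i : (rev w)`_i = 0 -> ~~ is_white w i.
Proof.
move=> i0; apply/negP => iw; have [[]] := (whitesP pw (ltn_ord i)).1; first by exact: iw.
by rewrite i0.
Qed.

Lemma whiteE i : white (rev w) i = is_white w i.
Proof.
have pE j : paired (rev w) i j = ((val i, val j) \in arcs w) := pairedP pw i (ltn_ord j).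
apply/andP/idP => [[/eqP i1 /existsPn H]|iw].
  case: (arcs_cover pw (ltn_ord i)) => [|//|[j [ij|ji]]]; first by rewrite i1.
    have jk : (j < k)%N by have := mem_arcs_lt pw ij; lia.
    by have := H (Ordinal jk); rewrite pE ij.
  by have [_] := arcs_letters pw ji; rewrite i1.
have [_ i1 _] := (whitesP pw (ltn_ord i)).1.1 iw.
split; first by rewrite i1.
by apply/existsPn => j; rewrite pE; apply/negP => /(arcs_not_white pw)[/negP].
Qed.

Lemma pairedE i j : paired (rev w) i j || paired (rev w) j i = joined w i j.
Proof. by rewrite !(pairedP pw) ?ltn_ord. Qed.

Lemma white_rank_inj i j : is_white w i -> is_white w j ->
  (white_rank (rev w) i == white_rank (rev w) j) = (i == j).
Proof.
have lt i' j' : (i' < j')%N -> is_white w i' ->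
  (white_rank (rev w) i' < white_rank (rev w) j')%N.
  move=> lt_ij iw; apply: proper_card; apply/properP; split.
    by apply/subsetP => t; rewrite !inE => /andP[-> ti]; rewrite (ltn_trans ti).
  by exists i'; rewrite !inE whiteE iw // ltnn.
move=> iw jw; apply/eqP/eqP => [e|-> //]; apply: val_inj.
case: (ltngtP i j) => // h; first by have := lt _ _ h iw; rewrite e ltnn.
by have := lt _ _ h jw; rewrite e ltnn.
Qed.

(** Both rows carry the same path, so equal white ranks mean equal columns and every vertical edge
    is straight. *)
Lemma dgmE b i b' j : dgm (rev w) (rev w) (b, i) (b', j) =
  if b == b' then joined w i j else (i == j) && is_white w i.
Proof.
have vert i' j' : [&& white (rev w) i', white (rev w) j' &
  white_rank (rev w) i' == white_rank (rev w) j']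
     = (i' == j') && is_white w i'.
  rewrite !whiteE; case iw: (is_white w i') => /=; last by rewrite andbF.
  case jw: (is_white w j') => /=; first by rewrite white_rank_inj // andbT.
  by rewrite andbT; apply/esym/negP => /eqP e; rewrite -e iw in jw.
case: b b' => [] [] /=; rewrite ?pairedE // vert //.
by case: (eqVneq j i) => [->|] //; rewrite eq_sym => /negPf ->.
Qed.

Lemma card_white : #|[set i | is_white w i]| = r.
Proof.
rewrite cardsE cardE -(size_whites pw) -(size_map val).
apply/eqP; rewrite -uniq_size_uniq ?(whites_uniq pw) //.
  by rewrite (map_inj_uniq val_inj) enum_uniq.
move=> i; apply/idP/mapP => [iw|[j + ->]]; last by rewrite mem_enum.
have ik : (i < k)%N := allP (whites_lt pw) _ iw.
by exists (Ordinal ik); rewrite // mem_enum.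
Qed.
End Mates.

(** * Components of the stacked diagram *)

Section Stack.
Variables (k r : nat) (w v : seq int).
Hypotheses (pw : motzw k r w) (pv : motzw k r v).
Implicit Types (i j : 'I_k) (x y : svtx k).

Notation d1 := (@dgm k (rev w) (rev w)).
Notation d2 := (@dgm k (rev v) (rev v)).
Notation mw := (mate (k := k) w).
Notation mv := (mate (k := k) v).
Notation conn := (connect (dihedral mw mv)).
Notation sconn := (connect (stackE d1 d2)).

Let mwK : involutive mw := mateK pw.
Let mvK : involutive mv := mateK pv.
Let csym := dihedral_sym mwK mvK.

Lemma dgm_sym u : motzw k r u -> symmetric (@dgm k (rev u) (rev u)).
Proof.
move=> pu [b i] [b' j]; rewrite !(dgmE pu) eq_sym; case: (b' == b); first exact: joined_sym.
by rewrite eq_sym; case: eqP => [->|].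
Qed.

Lemma stackEE x y : stackE d1 d2 x y = stack_edge d1 d2 x y.
Proof.
rewrite /stackE; suff -> : stack_edge d1 d2 y x = stack_edge d1 d2 x y by rewrite orbb.
rewrite /stack_edge (dgm_sym pw) (dgm_sym pv); by congr ((_ && _) || (_ && _));
  exact: andbC.
Qed.

Lemma sconn_sym : connect_sym (stackE d1 d2).
Proof. by apply: sym_connect_sym => x y; rewrite /stackE orbC. Qed.

(* The component of the middle vertex [i] of the stack. *)
Definition in_comp i x : bool :=
  [&& conn i x.2, (x.1 == 0 :> nat) ==> is_white w x.2 &
    (x.1 == 2 :> nat) ==> is_white v x.2].

Lemma joined_conn_w i j : joined w i j -> conn i j.
Proof. by move/(mate_joined pw) <-; apply: conn_s. Qed.

Lemma joined_conn_v i j : joined v i j -> conn i j.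
Proof. by move/(mate_joined pv) <-; apply: conn_t. Qed.

Lemma closed_sconn (A : pred (svtx k)) :
  (forall x y, stack_edge d1 d2 x y -> A x -> A y) -> forall x y, sconn x y -> A x -> A y.
Proof.
move=> cA x y /connectP[p]; elim: p x => [|z p IH] x /=; first by move=> _ ->.
by rewrite stackEE => /andP[xz zp] yl Ax; apply: (IH z) => //; apply: cA xz Ax.
Qed.

Lemma in_comp_edge i x y : stack_edge d1 d2 x y -> in_comp i x -> in_comp i y.
Proof.
case: x y => [a j] [b l]; rewrite /stack_edge /in_comp !(dgmE pw) !(dgmE pv) /=.
case: a => [[|[|[|a]]] //= la]; case: b => [[|[|[|b]]] //= lb];
  rewrite ?andbT ?orbF ?andbF //=.
- move=> jl /andP[ij jw]; by rewrite (white_not_joined pw _ jw) in jl.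
- by move=> /andP[/eqP<- jw] /andP[ij _].
- by move=> /andP[/eqP<- jw] ij; rewrite ij jw.
- case/orP=> jl ij; apply: connect_trans ij _; first exact: joined_conn_w.
  exact: joined_conn_v.
- by move=> /andP[/eqP<- jw] ij; rewrite ij jw.
- by move=> /andP[/eqP<- jw] /andP[ij _].
- move=> jl /andP[ij jw]; by rewrite (white_not_joined pv _ jw) in jl.
Qed.

Let mid i : svtx k := (inord 1, i).

Lemma mid_comp i : in_comp i (mid i).
Proof. by rewrite /in_comp /= inordK // connect0. Qed.

Lemma sconn_in_comp i x y : sconn x y -> in_comp i x -> in_comp i y.
Proof. by apply: closed_sconn => {}x {}y; apply: in_comp_edge. Qed.

Lemma conn_sconn i j : conn i j -> sconn (mid i) (mid j).
Proof.
move=> /connectP[p]; elim: p i => [|l p IH] i /=; first by move=> _ ->; rewrite connect0.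
move=> /andP[il lp] jl; apply: connect_trans (IH l lp jl).
case/orP: il => /eqP e.
  have [ei|ne] := eqVneq (mw i) i; first by rewrite -e ei connect0.
  by apply: connect1;
    rewrite stackEE /stack_edge !(dgmE pw) !(dgmE pv) /= !inordK //= -e (joined_mate pw ne).
have [ei|ne] := eqVneq (mv i) i; first by rewrite -e ei connect0.
by apply: connect1; rewrite stackEE /stack_edge !(dgmE pw) !(dgmE pv) /= !inordK //= -e (joined_mate pv ne) orbT.
Qed.

Lemma sconn_top i : is_white w i -> sconn (mid i) (ord0, i).
Proof.
by move=> iw; apply: connect1;
  rewrite stackEE /stack_edge !(dgmE pw) !(dgmE pv) /= !inordK //= eqxx iw.
Qed.

Lemma sconn_bot i : is_white v i -> sconn (mid i) (inord 2, i).
Proof.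
move=> iw; apply: connect1.
by rewrite stackEE /stack_edge !(dgmE pw) !(dgmE pv) /= !inordK //= eqxx iw.
Qed.

Lemma sconn_top_bot i j :
  sconn (ord0, i) (inord 2, j) = [&& is_white w i, is_white v j & conn i j].
Proof.
apply/idP/and3P => [h|[iw jv ij]]; last first.
  apply: connect_trans (connect_trans (conn_sconn ij) (sconn_bot jv)).
  by rewrite sconn_sym sconn_top.
have iw : is_white w i.
  apply/negPn/negP => niw.
  (* Top vertices that are not white are joined only to one another, so their component never leaves
     the top row. *)
  pose A (x : svtx k) := (x.1 == 0 :> nat) && ~~ is_white w x.2.
  have cl x y : stack_edge d1 d2 x y -> A x -> A y.
    case: x y => [a l] [b l']; rewrite /A /stack_edge !(dgmE pw) !(dgmE pv) /=.
    case: a => [[|a] //= la]; rewrite ?andbF //= orbF.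
    case: b => [[|[|[|b]]] //= lb]; rewrite ?andbF //=.
      move=> ll' nl; apply/negP => l'w.
      by rewrite joined_sym (white_not_joined pw _ l'w) in ll'.
    by move=> /andP[_ ->].
  by have := closed_sconn cl h; rewrite /A /= inordK // niw => /(_ isT).
have := sconn_in_comp (i := i) h; rewrite /in_comp /= inordK // connect0 iw /=.
by case/(_ isT)/andP => ij jv.
Qed.

(** Only the white vertices of [w] can reach the bottom row, and there are [r] of them, so rank [r]
    means that all do. *)
Lemma prod_rankE :
  (prod_rank d1 d2 == r) = [forall i, is_white w i ==> [exists j, is_white v j && conn i j]].
Proof.
rewrite /prod_rank -(card_white pw).
have -> : [set i | [exists j, sconn (ord0, i) (inord 2, j)]] =
  [set i | is_white w i & [exists j, is_white v j && conn i j]].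
  apply/setP => i; rewrite !inE; apply/existsP/andP => [[j]|[iw /existsP[j jc]]].
    by rewrite sconn_top_bot => /and3P[iw jv ij]; split=> //; apply/existsP; exists j;
      rewrite jv.
  by exists j; rewrite sconn_top_bot iw.
set A := [set i | _ & _]; set B := [set i | _].
have AB : A \subset B by apply/subsetP => i; rewrite !inE => /andP[].
apply/idP/forallP => [cAB i|H].
  have /eqP/setP/(_ i) : A == B by rewrite eqEcard AB (eqP cAB) leqnn.
  by rewrite !inE => e; apply/implyP => iw; move: e; rewrite iw /= => ->.
suff -> : A = B by [].
by apply/setP => i; rewrite !inE; case iw: (is_white w i) => //=; move/implyP: (H i) => ->.
Qed.

(** A fixed point of a mate is either white, and its component then reaches an outer row, or flat,
    and it then lies on no edge of that diagram. *)
Lemma on_loop_mid i : on_loop d1 d2 (mid i) = loopy mw mv i.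
Proof.
have ex u j b : motzw k r u -> [exists z, @dgm k (rev u) (rev u) (b, j) z] =
    (mate u j != j) || is_white u j.
  move=> pu; rewrite (mateP pu) negbK; apply/existsP/orP => [[[b' l]]|[/existsP[l jl]|ju]].
  - rewrite (dgmE pu); case: (b == b') => [jl|/andP[_ ->]]; last by right.
    by left; apply/existsP; exists l.
  - by exists (b, l); rewrite (dgmE pu) eqxx.
  - by exists (~~ b, j); rewrite (dgmE pu) eqxx ju; case: b.
apply/forallP/forallP => [H j|H [a j]]; apply/implyP.
  move=> ij; have := H (mid j);
    rewrite (conn_sconn ij) (ex _ _ _ pw) (ex _ _ _ pv) /= inordK //=.
  have nw : is_white w j = false.
    apply/negP => jw; have := H (ord0, j).
    by rewrite (connect_trans (conn_sconn ij) (sconn_top jw)).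
  have nv : is_white v j = false.
    apply/negP => jv; have := H (inord 2, j).
    by rewrite (connect_trans (conn_sconn ij) (sconn_bot jv)) /= inordK.
  by rewrite nw nv !orbF.
move=> /sconn_in_comp/(_ (mid_comp i))/and3P[ij a0 a2]; rewrite /= in ij a0 a2.
have /andP[sj tj] : (mw j != j) && (mv j != j) by move/implyP: (H j) => ->.
rewrite (ex _ _ _ pw) (ex _ _ _ pv) /= sj tj /= !andbT.
have nw : is_white w j = false by apply/negP => /(white_mate pw) e; rewrite e eqxx in sj.
have nv : is_white v j = false by apply/negP => /(white_mate pv) e; rewrite e eqxx in tj.
by move: a0 a2; rewrite nw nv; case: a => [[|[|[|a]]]].
Qed.

Lemma on_loop_layer x : on_loop d1 d2 x -> x = mid x.2.
Proof.
move=> /forallP/(_ x); rewrite connect0 => /and3P[/eqP x1 _ _].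
by case: x x1 => a i /= a1; congr (_, _); apply: val_inj; rewrite /= inordK.
Qed.

Lemma nloopsE : nloops d1 d2 = #|loop_roots mw mv|.
Proof.
rewrite /nloops; pose comp i := [set y | sconn (mid i) y].
have mid_conn i j : sconn (mid i) (mid j) = conn i j.
  apply/idP/idP => [/sconn_in_comp/(_ (mid_comp i))/and3P[]//|]; exact: conn_sconn.
rewrite -(@card_in_imset _ _ comp (mem (loop_roots mw mv))); last first.
  move=> i j; rewrite !inE => /andP[_ /eqP ri] /andP[_ /eqP rj] /setP/(_ (mid j)).
  rewrite !inE connect0 mid_conn => ij.
  by rewrite -ri -rj; apply/eqP; rewrite (root_connect csym).
congr (#|pred_of_set _|); apply/setP => S; apply/imsetP/imsetP => [[x]|[i]]; last first.
  by rewrite !inE => /andP[li _] ->; exists (mid i); rewrite ?inE ?on_loop_mid.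
rewrite inE => lx ->; have e := on_loop_layer lx; rewrite e on_loop_mid in lx.
rewrite {}e; move: x.2 lx => i lx; exists (fingraph.root (dihedral mw mv) i).
  by rewrite !inE -(loopy_conn mwK mvK (connect_root _ i)) lx (root_root csym) eqxx.
apply/setP => y; rewrite !inE; apply: (same_connect sconn_sym).
by rewrite mid_conn connect_root.
Qed.

End Stack.

(** * Values of the form at integers *)

Lemma sumw_tuple (R : comNzRingType) (C : finType) k (F : seq C -> R) :
  sumw k F = \sum_(t : k.-tuple C) F t.
Proof.
elim: k F => [|k IH] F.
  by rewrite (big_pred1 [tuple]) // => t; apply/esym/eqP; apply: tuple0.
rewrite sumwS; under eq_bigr => x _ do rewrite IH.
rewrite pair_big /= (reindex (fun t : k.+1.-tuple C => (thead t, [tuple of behead t]))) /=.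
  by apply: eq_bigr => t _; rewrite [in RHS](tuple_eta t).
exists (fun xt : C * k.-tuple C => [tuple of xt.1 :: xt.2]) => [t _|[x t] _] /=.
  by rewrite -tuple_eta.
by rewrite theadE; congr (_, _); apply: val_inj.
Qed.

Definition colouring_seq (C : finType) k (g : {ffun 'I_k -> C}) : seq C :=
  [tuple g (rev_ord i) | i < k].

Lemma sumw_ffun (R : comNzRingType) (C : finType) k (F : seq C -> R) :
  sumw k F = \sum_(g : {ffun 'I_k -> C}) F (colouring_seq g).
Proof.
rewrite sumw_tuple (reindex (fun g : {ffun 'I_k -> C} => [tuple g (rev_ord i) | i < k])) //.
exists (fun t => [ffun i => tnth t (rev_ord i)]) => [g _|t _].
  by apply/ffunP => i; rewrite ffunE tnth_mktuple rev_ordK.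
by apply: eq_from_tnth => i; rewrite tnth_mktuple ffunE rev_ordK.
Qed.

Section Evaluation.
Variables (M k r : nat) (w v : seq int).
Notation C := 'I_M.+1.
Hypotheses (pw : motzw k r w) (pv : motzw k r v) (rM : (r <= M)%N).
Notation mw := (mate (k := k) w).
Notation mv := (mate (k := k) v).
Notation conn := (connect (dihedral mw mv)).

Lemma size_colouring (g : {ffun 'I_k -> C}) : size (colouring_seq g) = k.
Proof. by rewrite size_tuple. Qed.

Lemma colour_at_colouring (g : {ffun 'I_k ->
  C}) i : colour_at (colouring_seq g) (val i) = g i.
Proof.
rewrite /colour_at size_colouring -[(k - _)%N]/(val (rev_ord i)) /colouring_seq -tnth_nth.
by rewrite tnth_mktuple rev_ordK.
Qed.

Definition prescribed u (s : seq C) (i : 'I_k) : C :=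
  if is_white u i then nth ord0 s (index (val i) (whites u)) else ord0.

Lemma compat_mate u s (g : {ffun 'I_k -> C}) : motzw k r u -> size s = r ->
  compat u (colouring_seq g) s <->
  forall i, g (mate u i) = g i /\ (mate u i = i -> g i = prescribed u s i).
Proof.
move=> pu ss; have E := compatP pu (size_colouring g) ss.
have iff3 (A B D : Prop) : (A <-> B) -> (B <-> D) -> (A <-> D) by tauto.
apply: (iff3 _ _ _ E) => {iff3 E}; split.
  move=> [H0 Ha Hw] i; split.
    have [->//|ne] := eqVneq (mate u i) i.
    have := joined_mate pu ne; rewrite /joined => /orP[] /Ha;
      rewrite !colour_at_colouring //.
  move=> /(mate_fixed pu) mf; rewrite /prescribed; case: ifP => iw.
    by rewrite -Hw // colour_at_colouring.
  by case: mf => [iw'|i0];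
    [rewrite iw' in iw | rewrite -(colour_at_colouring g i) H0 ?ltn_ord].
move=> H; split.
- move=> i ik i0; rewrite -[i]/(val (Ordinal ik)) colour_at_colouring.
  have fix_i : mate u (Ordinal ik) = Ordinal ik := flat_mate pu (i := Ordinal ik) i0.
  rewrite (H _).2 //.
  by rewrite /prescribed (negPf (flat_not_white pu (i := Ordinal ik) i0)).
- move=> i j ij; have := mem_arcs_lt pu ij => /andP[lt_ij jk].
  have ik := ltn_trans lt_ij jk.
  rewrite -[i]/(val (Ordinal ik)) -[j]/(val (Ordinal jk)) !colour_at_colouring.
  have <- : mate u (Ordinal ik) = Ordinal jk by apply: (mate_joined pu); rewrite /joined ij.
  by rewrite (H _).1.
- move=> i iw; have ik : (i < k)%N := allP (whites_lt pu) _ iw.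
  rewrite -[i]/(val (Ordinal ik)) colour_at_colouring.
  have wi : is_white u (Ordinal ik) by [].
  by rewrite (H _).2 ?(white_mate pu) // /prescribed wi.
Qed.

Lemma wform_card (R : comNzRingType) s t : size s = r -> size t = r ->
  wform (M := M) R k w v s t =
  #|[set g : {ffun 'I_k -> C} | respects mw mv (prescribed w s) (prescribed v t) g]|%:R.
Proof.
move=> ss st; rewrite /wform sumw_ffun -sum1_card natr_sum [RHS]big_mkcond /=.
apply: eq_bigr => g _; rewrite inE /wvec -natrM mulnb.
have -> : compat w (colouring_seq g) s && compat v (colouring_seq g) t =
   respects mw mv (prescribed w s) (prescribed v t) g.
  apply/andP/respectsP => [[/(compat_mate _ pw ss) H1 /(compat_mate _ pv st) H2] i|H].
    by have [? ?] := H1 i; have [? ?] := H2 i.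
  by split; [apply/(compat_mate _ pw ss) | apply/(compat_mate _ pv st)] => i;
    have [] := H i.
by case: respects.
Qed.

(** Planarity enters here: the indicator of [std r] is a Jones-Wenzl vector, so only the identity
    diagram is seen. *)
Lemma wform_std (R : fieldType) t : size t = r ->
  wform (M := M) R k w v (std M r) t =
  wform (M := M) R k w v (std M r) (std M r) * (t == std M r)%:R.
Proof.
move=> st.
have := @wform_jw_std R M k w v r r _ t rM (leqnn _) pw pv (jw_std _ rM) st.
rewrite eqxx => <-; apply: eq_sumw => c _; congr (_ * _).
by rewrite (sumw_delta (fun s => wvec R w s c)) // size_std.
Qed.

Lemma std_neq0 n : (n < r)%N -> nth ord0 (std M r) n != ord0.
Proof.
move=> nr; apply/eqP => e; have := @mem_std M r ord0 rM.
by rewrite -{1}e mem_nth ?size_std // => /(_ isT).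
Qed.

Lemma index_white_lt u i : motzw k r u -> is_white u i ->
  (index (val (i : 'I_k)) (whites u) < r)%N.
Proof. by move=> pu iw; rewrite -(size_whites pu) index_mem. Qed.

(** If the rank drops, some white vertex of [w] lies in a component whose other end demands the
    colour 0 or is another white vertex of [w] with a different label, so no colouring exists. At
    full rank a colouring is transported from [w] to [v], and only the free colours of the loops
    remain to be counted. *)
Lemma wform_eval (R : fieldType) : [pchar R] =i pred0 ->
  wform (M := M) R k w v (std M r) (std M r) =
  if prod_rank (@dgm k (rev w) (rev w)) (@dgm k (rev v) (rev v)) == r then
    M.+1%:R ^+ nloops (@dgm k (rev w) (rev w)) (@dgm k (rev v) (rev v))
  else 0.
Proof.
move=> char0; rewrite (prod_rankE pw pv) (nloopsE pw pv).
have [mwK mvK] := (mateK pw, mateK pv).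
have csym := dihedral_sym mwK mvK.
case: ifP => [/forallP H|/negbT]; last first.
  rewrite negb_forall => /existsP[i]; rewrite negb_imply => /andP[iw /existsPn noj].
  rewrite wform_card ?size_std // (_ : [set g | _] = set0) ?cards0 //.
  apply/setP => g; rewrite !inE; apply/negP => /respectsP Rg.
  have gc x y : conn x y -> g x = g y by apply: dihedral_const => z; have [] := Rg z.
  have gi : g i = nth ord0 (std M r) (index (val i) (whites w)).
    by have [_ _ -> //] := Rg i; [rewrite /prescribed iw | rewrite (white_mate pw)].
  have g0 : g i != ord0 by rewrite gi std_neq0 // index_white_lt.
  case: (dihedral_other_end mwK mvK (white_mate pw iw)) => [[j tj ij]|[j sj [ji ij]]].
    have := noj j; rewrite ij andbT => jw.
    have [_ _ _ /(_ tj)] := Rg j; rewrite /prescribed (negPf jw) => gj.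
    by rewrite (gc _ _ ij) gj eqxx in g0.
  have [_ _ /(_ sj)] := Rg j; rewrite /prescribed; case: ifP => jw gj _; last first.
    by rewrite (gc _ _ ij) gj eqxx in g0.
  move: ji; rewrite -val_eqE -(nth_index 0%N iw) -(nth_index 0%N jw).
  have : index (val i) (whites w) = index (val j) (whites w).
    apply/eqP; rewrite -(nth_uniq ord0 _ _ (uniq_std rM)) ?size_std ?index_white_lt //.
    by rewrite -gi -gj (gc _ _ ij).
  by move=> ->; rewrite eqxx.
pose c0 (x : 'I_k) : C := if [pick i | is_white w i && conn i x] is Some i
  then nth ord0 (std M r) (index (val i) (whites w)) else ord0.
have partner i : is_white w i -> exists2 j, is_white v j & conn i j.
  by move=> iw; have /implyP/(_ iw)/existsP[j /andP[jv ij]] := H i; exists j.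
(* The labels that [c0] induces on the white vertices of [v]. That [t = std r] is not checked on the
   diagram: the count for [std r] and [t] is a power of [M + 1], nonzero in characteristic 0,
   whereas [wform_std] gives 0 for any other [t]. *)
pose t := [seq (if insub n is Some i then c0 i else ord0) | n <- whites v].
have st : size t = r by rewrite size_map (size_whites pv).
have c0R : respects mw mv (prescribed w (std M r)) (prescribed v t) c0.
  have c0c x y : conn x y -> c0 x = c0 y.
    move=> xy; rewrite /c0; congr (match _ with Some i => _ | None => _ end).
    by apply: eq_pick => i /=; rewrite (same_connect_r csym xy).
  apply/respectsP => x; split.
  - by rewrite (c0c _ _ (conn_s mw mv x)).
  - by rewrite (c0c _ _ (conn_t mw mv x)).
  - move=> sx; rewrite /c0 /prescribed; case: pickP => [i /andP[iw ix]|none].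
      have [j jv ij] := partner i iw.
      have <- := dihedral_ends_uniq mwK mvK (white_mate pw iw) sx (white_mate pv jv) ix ij.
      by rewrite iw.
    by case: ifP => // xw; have := none x; rewrite xw connect0.
  - move=> tx; rewrite /prescribed; case: ifP => xv.
      rewrite (nth_map 0%N) ?nth_index // -?index_mem //; last by rewrite index_mem.
      by case: insubP => [u _ ux|]; [congr c0; apply: val_inj | rewrite ltn_ord].
    rewrite /c0; case: pickP => [i /andP[iw ix]|//].
    have [j jv ij] := partner i iw.
    have mm : connect_sym (dihedral mv mw) := dihedral_sym mvK mwK.
    have sw x1 x2 : connect (dihedral mv mw) x1 x2 = conn x1 x2.
      by apply: eq_connect => a b; rewrite /dihedral orbC.
    have := @dihedral_ends_uniq _ mv mw mvK mwK j x i (white_mate pv jv) tx (white_mate pw iw).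
    rewrite !sw [conn j x](same_connect csym (y := i)); last by rewrite csym.
    by rewrite [conn j i]csym => /(_ ix ij) jx; rewrite -jx jv in xv.
have := @wform_card R (std M r) t (size_std M r) st.
rewrite (card_respects ord0 mwK mvK c0R) card_ord (wform_std R st) natrX.
case: eqP => [_|_]; first by rewrite mulr1.
rewrite mulr0 => /esym/eqP; rewrite expf_eq0 => /andP[_].
by move/pcharf0P: char0 => ->.
Qed.
End Evaluation.

(** * Transfer to rational functions *)

Lemma rmorph_cheb (R S : nzRingType) (f : {rmorphism R -> S}) y n :
  f (cheb y n) = cheb (f y) n.
Proof.
suff [] : f (cheb y n) = cheb (f y) n /\ f (cheb y n.+1) = cheb (f y) n.+1 by [].
elim: n => [|n [IH1 IH2]]; first by rewrite !cheb0 !cheb1 rmorph1.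
by split=> //; rewrite !chebS rmorphB rmorphM IH1 IH2.
Qed.

(** A polynomial version of the form: it can be evaluated at integers, unlike an element of the
    fraction field. *)
Definition form_poly (k r : nat) (p q : seq int) : {poly rat} :=
  let d1 := @dgm k p p in let d2 := @dgm k q q in
  if prod_rank d1 d2 == r then 'X ^+ nloops d1 d2 else 0.

Definition Gram_poly (k r : nat) : 'M[{poly rat}]_(mkr k r) :=
  \matrix_(i, j) form_poly k r (nth [::] (motz k r) i) (nth [::] (motz k r) j).

Lemma det_Gram_tofrac k r : \det (Gram k r) = FracField.tofrac (\det (Gram_poly k r)).
Proof.
rewrite -det_map_mx; congr (\det _); apply/matrixP => i j; rewrite !mxE.
by rewrite /Defs.form /form_poly; case: ifP => _; rewrite ?rmorphXn ?rmorph0.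
Qed.

(** [paths] lists the reversed words in another order, which permutes rows and columns
    simultaneously. *)
Lemma horner_det_Gram k r M : (r <= M)%N ->
  (\det (Gram_poly k r)).[M.+1%:R] = celldet rat M k r.
Proof.
move=> rM; rewrite -[LHS]/(horner_eval M.+1%:R _) -det_map_mx /celldet size_paths.
have sz : size [seq rev p | p <- motz k r] = mkr k r by rewrite size_map.
rewrite -(det_gram_perm [::] (cellform rat M k r) sz (perm_motz_paths k r)).
congr (\det _); apply/matrixP => i j; rewrite !mxE !(nth_map [::]) ?ltn_ord //.
set p := nth _ _ i; set q := nth _ _ j.
have pw : motzw k r (rev p) by apply/motz_motzw/mem_nth/ltn_ord.
have qw : motzw k r (rev q) by apply/motz_motzw/mem_nth/ltn_ord.
rewrite /cellform (wform_eval pw qw rM (pchar_num _)) !revK /form_poly /horner_eval.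
by case: ifP => _; rewrite /= /horner_eval ?hornerXn ?horner0.
Qed.

Lemma poly_eq_nat (p q : {poly rat}) N :
  (forall n : nat, (N <= n)%N -> p.[n%:R] = q.[n%:R]) -> p = q.
Proof.
move=> H; apply/eqP; rewrite -subr_eq0; apply/negPn/negP => pq0.
pose s : seq rat := [seq (N + i)%:R | i <- iota 0 (size (p - q))].
have us : uniq s.
  rewrite map_inj_uniq ?iota_uniq // => i j /eqP.
  by rewrite eqr_nat eqn_add2l => /eqP.
have rs : all (root (p - q)) s.
  apply/allP => x /mapP[i _ ->]; rewrite rootE hornerD hornerN H ?subrr //.
  exact: leq_addr.
by have := max_poly_roots pq0 rs us; rewrite size_map size_iota ltnn.
Qed.

Definition uP n : {poly rat} := cheb ('X - 1) n.

Lemma uP_tofrac n : FracField.tofrac (uP n) = uQ n.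
Proof. by rewrite rmorph_cheb rmorphB rmorph1. Qed.

Lemma uP_horner n M : (uP n).[M.+1%:R] = cheb (M%:R : rat) n.
Proof.
rewrite -[LHS]/(horner_eval M.+1%:R _) rmorph_cheb; congr cheb.
by rewrite /= /horner_eval !hornerE -natr1 addrK.
Qed.

Lemma cheb_nat_neq0 M n : (1 < M)%N -> cheb (M%:R : rat) n != 0.
Proof. by move=> M1; rewrite gt_eqF // cheb_gt0 // ler_nat. Qed.

Lemma uQ_neq0 n : uQ n != 0.
Proof.
rewrite -uP_tofrac tofrac_eq0; apply/eqP => u0.
by have := cheb_nat_neq0 n (isT : 1 < 2)%N; rewrite -uP_horner u0 horner0 eqxx.
Qed.

(** Denominators are cleared so that both sides are polynomials, determined by their values at large
    integers. *)
Lemma det_Gram_poly k r L : (k <= L)%N ->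
  \det (Gram_poly k r) * \prod_(s < L) uP s ^+ mkr k (r + s.*2).+2 =
  \prod_(s < L) uP (s + r).+1 ^+ mkr k (r + s.*2).+2.
Proof.
(* At [n = M + 1] the bound gives [M >= k + r + 3], enough for [k + r < M] and for [M >= 2]. *)
move=> kL; apply: (@poly_eq_nat _ _ (k + r).+4) => -[|M] // kM.
have u0 n : cheb (M%:R : rat) n != 0 by apply: cheb_nat_neq0; lia.
rewrite hornerM !horner_prod horner_det_Gram; last lia.
rewrite (celldet_formula u0 (L := L)) //; last lia.
rewrite -big_split; apply: eq_bigr => s _ /=.
by rewrite !horner_exp !uP_horner size_paths -exprMn divfK.
Qed.

Lemma det_Gram k r L : (k <= L)%N -> \det (Gram k r) =
  \prod_(s < L) (uQ (s + r).+1 / uQ s) ^+ mkr k (r + s.*2).+2.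
Proof.
move=> kL; have := congr1 (fun p => FracField.tofrac p) (det_Gram_poly r kL).
rewrite tofracM -det_Gram_tofrac !rmorph_prod /=.
under eq_bigr => s _ do rewrite tofracXn uP_tofrac.
under [in RHS]eq_bigr => s _ do rewrite tofracXn uP_tofrac.
move=> E; rewrite (eq_bigr _ (fun s _ =>
  exprMn _ _ _)) big_split /= -E -mulrA -big_split /=.
rewrite big1 ?mulr1 // => s _.
by rewrite exprVn divff // expf_neq0 ?uQ_neq0.
Qed.

Lemma mkr_gt k r : (k < r)%N -> mkr k r = 0%N.
Proof. by rewrite -size_paths; apply: size_paths_gt. Qed.

Lemma mkr_diag k : mkr k k = 1%N.
Proof.
rewrite -size_paths; elim: k => // k IH.
by rewrite size_pathsS IH !size_paths_gt.
Qed.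

Lemma mkr_subdiag k : mkr k.+1 k = k.+1.
Proof.
rewrite -size_paths; elim: k => // k IH.
by rewrite size_pathsS IH !size_paths !mkr_diag mkr_gt // addn0 addn1.
Qed.

Lemma det_Gram_product (k r : nat) : (r <= k)%N ->
  \det (Gram k r) =
  \prod_(1 <= s < ((k - r)./2).+1) (uQ (s + r) / uQ (s - 1)) ^+ mkr k (r + 2 * s).
Proof.
move=> rk; rewrite (det_Gram r (leqnn k)) big_add1 /=.
rewrite -(big_mkord xpredT (fun s => (uQ (s + r).+1 / uQ s) ^+ mkr k (r + s.*2).+2)).
(* For zero-based [s >= (k - r)./2] the rank [r + 2s + 2] exceeds [k], so the exponent is 0. *)
rewrite (big_cat_nat (n := (k - r)./2)) //=; last by have := half_leq (leq_subr r k); lia.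
rewrite [X in _ * X]big_nat_cond [X in _ * X]big1 ?mulr1 => [|s /andP[/andP[h1 h2] _]];
  last first.
  by rewrite mkr_gt ?expr0 //; have := odd_double_half (k - r); lia.
apply: eq_bigr => s _; rewrite addSn subn1 /=; congr (_ ^+ mkr _ _); lia.
Qed.

Theorem mainTheorem16 :
  (forall k r : nat, (1 <= k)%N -> (r <= k)%N ->
     \det (Gram k r) =
     \prod_(1 <= s < ((k - r)./2).+1)
        (uQ (s + r) / uQ (s - 1)) ^+ mkr k (r + 2 * s))
  /\ (forall k : nat, (1 <= k)%N ->
        \det (Gram k k) = 1 /\ \det (Gram k (k - 1)) = 1)
  /\ (forall k : nat, (2 <= k)%N -> \det (Gram k (k - 2)) = uQ (k - 1))
  /\ (forall k : nat, (3 <= k)%N -> \det (Gram k (k - 3)) = uQ (k - 2) ^+ k).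
Proof.
split=> [k r _|]; first exact: det_Gram_product.
have uQ0 : uQ 0 = 1 by [].
split=> [k k1|].
  rewrite !det_Gram_product ?leq_subr // subnn subKn //.
  by rewrite !big_geq.
(* Only the factor [s = 1] is left, with [u_0 = 1] below; its exponent is [m_(k, k) = 1] or
   [m_(k, k-1) = k]. *)
split=> k hk; rewrite det_Gram_product ?leq_subr // subKn // big_nat1 subnn uQ0 divr1.
  by rewrite muln1 subnK // mkr_diag expr1; congr uQ; lia.
case: k hk => // k hk; rewrite (_ : (k.+1 - 3 + 2 * 1 = k)%N); last lia.
by rewrite mkr_subdiag; congr (uQ _ ^+ _); lia.
Qed.
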